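(* Let $N\geq 3$, $p>1$ and $m\in\mathbb N$ be fixed, and set $\alpha_p:=\max\left\{0,\frac{p(N-2)-(N+2)}{2}\right\}$. For $\alpha>\alpha_p$ let $u_\alpha$ be the unique radial solution of $-\Delta u=|x|^\alpha|u|^{p-1}u$ in $B^N$, $u=0$ on $\partial B^N$, with exactly $m$ nodal sets and $u_\alpha(0)>0$, and let $w$ be the unique radial solution of $-\Delta w=|w|^{p-1}w$ in $B^2$, $w=0$ on $\partial B^2$, with exactly $m$ nodal sets and $w(0)>0$. Let $r_{1,\alpha}<\cdots<r_{m-1,\alpha}<r_{m,\alpha}=1$ be the zeros of $u_\alpha$ in $(0,1]$ and $t_1<\cdots<t_{m-1}<t_m=1$ the zeros of $w$ in $(0,1]$. Set $\mathcal M_{1,\alpha}:=\max\{u_\alpha(r):0\leq r\leq r_{1,\alpha}\}$ and $\mathcal M_{i+1,\alpha}:=\max\{|u_\alpha(r)|:r_{i,\alpha}\leq r\leq r_{i+1,\alpha}\}$ for $i=1,\dots,m-1$. Then: (i) for each $i=1,\dots,m$, $\alpha(1-r_{i,\alpha})\to-2\log(t_i)$ as $\alpha\to\infty$; (ii) for each $0<R_0<1$, $\left(\frac{2}{\alpha+2}\right)^{\frac{2}{p-1}}u_\alpha(x)\to w(0)$ uniformly in $B(0,R_0)=\{x\in\mathbb R^N:|x|<R_0\}$ as $\alpha\to\infty$; (iii) there exist $\alpha_0>\alpha_p$ and constants $C_1,C_2>0$ such that $$C_1\left(\frac{\alpha+2}{2}\right)^{\frac{2}{p-1}}\leq\mathcal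 M_{i,\alpha}\leq C_2\left(\frac{\alpha+2}{2}\right)^{\frac{2}{p-1}}$$ for all $i=1,\dots,m$ and all $\alpha\geq\alpha_0$.
   Context: $B^N\subset\mathbb R^N$, $B^2\subset\mathbb R^2$ are the open unit balls centered at the origin; radial functions are identified with functions of the radius on $[0,1]$. A nodal set is a connected component of the set where the function does not vanish. *)

(* Defs.v *)
From HB Require Import structures.
From mathcomp Require Import all_boot all_order all_algebra.
From mathcomp Require Import all_classical all_reals all_analysis.
Set Implicit Arguments. Unset Strict Implicit. Unset Printing Implicit Defensive.
Import Order.TTheory GRing.Theory Num.Theory.
Import numFieldNormedType.Exports.
Local Open Scope classical_set_scope.
Local Open Scope ring_scope.

Section Defs.
Variable R : realType.

(* Euclidean norm |x| on R^N (the library norm on 'rV is the sup norm). *)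
Definition enorm (N : nat) (x : 'rV[R]_N) : R :=
  Num.sqrt (\sum_(i < N) x ord0 i ^+ 2).

Definition eball (N : nat) (c : R) : set 'rV[R]_N := [set x | enorm x < c].
Definition ecball (N : nat) (c : R) : set 'rV[R]_N := [set x | enorm x <= c].

Definition evec (N : nat) (i : 'I_N) : 'rV[R]_N := \row_(j < N) (i == j)%:R.

Definition laplacian (N : nat) (U : 'rV[R]_N -> R) (x : 'rV[R]_N) : R :=
  \sum_(i < N) 'D_(evec i) ('D_(evec i) U) x.

Definition C2_on (N : nat) (B : set 'rV[R]_N) (U : 'rV[R]_N -> R) : Prop :=
  forall x, B x ->
    [/\ differentiable U x,
        forall i : 'I_N, differentiable ('D_(evec i) U) x &
        forall i j : 'I_N, {for x, continuous ('D_(evec j) ('D_(evec i) U))}].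

Definition radial (N : nat) (f : R -> R) : 'rV[R]_N -> R := fun x => f (enorm x).

Definition radial_dirichlet_sol (N : nat) (V : 'rV[R]_N -> R) (p : R)
    (f : R -> R) : Prop :=
  let U := @radial N f in
  [/\ C2_on (@eball N 1) U,
      {within @ecball N 1, continuous U},
      (forall x, @eball N 1 x ->
         - laplacian U x = V x * (powR `|U x| (p - 1)) * U x) &
      (forall x : 'rV[R]_N, enorm x = 1 -> U x = 0)].

Definition has_n_components (T : topologicalType) (A : set T) (m : nat) : Prop :=
  exists C : 'I_m -> T,
    [/\ (forall i, A (C i)),
        (forall i j, connected_component A (C i) = connected_component A (C j)
                     -> i = j) &
        (forall x, A x -> exists i, connected_component A (C i) x)].

Definition n_nodal_sets (N : nat) (f : R -> R) (m : nat) : Prop :=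
  has_n_components [set x : 'rV[R]_N | @eball N 1 x /\ @radial N f x != 0] m.

Definition zeros_of (f : R -> R) (m : nat) (z : nat -> R) : Prop :=
  [/\ (forall i, (1 <= i < m)%N -> z i < z i.+1),
      z m = 1,
      (forall i, (1 <= i <= m)%N -> 0 < z i <= 1 /\ f (z i) = 0) &
      (forall s, 0 < s <= 1 -> f s = 0 -> exists2 i, (1 <= i <= m)%N & z i = s)].

Definition Mmax (f : R -> R) (z : nat -> R) (i : nat) : R :=
  if i == 1%N then sup [set f r | r in `[0, z 1%N]]
  else sup [set `|f r| | r in `[z i.-1, z i]].

Definition alpha_p (N : nat) (p : R) : R :=
  Num.max 0 ((p * (N%:R - 2) - (N%:R + 2)) / 2).

End Defs.
Arguments radial {R} N f _.
Arguments eball {R} N c _.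
Arguments ecball {R} N c _.
Arguments n_nodal_sets {R} N f m.
Arguments alpha_p {R} N p.

(* Main.v *)
(* The proof rests on the substitution s = rho * |x|^((alpha+2)/2): it turns u_alpha,
   normalised to be 1 at the origin, into a solution y on (0, rho] of the Emden
   equation y'' + (1+d)/s y' + |y|^(p-1) y = 0 with y(0) = 1 and y(rho) = 0, where
   d = 2(N-2)/(alpha+2) tends to 0 and rho = 2/(alpha+2) u_alpha(0)^((p-1)/2).
   The same substitution (with N = 2 and alpha = 0) makes w a solution of the limit
   equation d = 0, so everything reduces to continuous dependence on d.  The energy
   y'^2/2 + |y|^(p+1)/(p+1) decreases while s^4 times it increases; hence |y| <= 1,
   |y'| <= s, and y, y' are never small together, uniformly in d.  A Gronwall
   estimate then gives C^1-closeness to the limit profile and, zeros being simple,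
   convergence of each zero; in particular rho, being the last zero, converges. *)
Require Import Defs.
From HB Require Import structures.
From mathcomp Require Import all_boot all_order all_algebra.
From mathcomp Require Import all_classical all_reals all_analysis.
From mathcomp Require Import ring lra.
Set Implicit Arguments. Unset Strict Implicit. Unset Printing Implicit Defensive.
Import Order.TTheory GRing.Theory Num.Theory.
Import numFieldNormedType.Exports.
Local Open Scope classical_set_scope.
Local Open Scope ring_scope.

(** * Real functions and the nonlinearity *)

(** No bound on the amplitude [u_alpha(0)] is known beforehand. Normalising the value at the origin
    moves this unknown into the endpoint [rho]: solutions with different [d] then share their
    initial data but live on different intervals, and can be compared only up to the shorter one. As
    that interval might end early, zeros are matched by induction on their index. A uniform gap
    between consecutive zeros keeps them from merging, and [rho], being a zero of known index,
    cannot lie far from its counterpart. The other difficulty is the singular coefficient at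
    [s = 0]. It is a damping, with a favourable sign in the Gronwall estimate, and the bound
    [|y'| <= s] makes the perturbation [d * y' / s] at most [d]. *)

Section RealFunctions.
Variable R : realType.
Implicit Types (f df : R -> R) (a b l x y : R).

Lemma derivable_continuous_oo f df a b :
  (forall x, a < x < b -> is_derive x 1 f (df x)) ->
  forall x y, a < x -> y < b -> {within `[x, y], continuous f}.
Proof.
move=> Df x y ax yb; apply: derivable_within_continuous => z.
rewrite in_itv /= => /andP[xz zy].
have := Df z; rewrite (lt_le_trans ax xz) (le_lt_trans zy yb) => /(_ isT) h.
by apply: ex_derive.
Qed.

Lemma MVT_oo f df a b :
  (forall x, a < x < b -> is_derive x 1 f (df x)) ->
  forall x y, a < x -> x <= y -> y < b ->
  exists2 c, x <= c <= y & f y - f x = df c * (y - x).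
Proof.
move=> Df x y ax xy yb.
have [|c cI e] := @MVT_segment R f df x y xy _ (@derivable_continuous_oo f df a b Df x y ax yb).
  by move=> z; rewrite in_itv /= => /andP[xz zy]; apply: Df;
    rewrite (lt_trans ax xz) (lt_trans zy yb).
by exists c => //; move: cI; rewrite in_itv.
Qed.

Lemma is_derive_nondecreasing f df a b :
  (forall x, a < x < b -> is_derive x 1 f (df x)) ->
  (forall x, a < x < b -> 0 <= df x) ->
  forall x y, a < x -> x <= y -> y < b -> f x <= f y.
Proof.
move=> Df df0 x y ax xy yb.
have [c /andP[xc cy] e] := @MVT_oo f df a b Df x y ax xy yb.
rewrite -subr_ge0 e mulr_ge0 ?subr_ge0// df0//.
by rewrite (lt_le_trans ax xc) (le_lt_trans cy yb).
Qed.

Lemma at_right_le_nondecreasing f a b l :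
  f x @[x --> a^'+] --> l ->
  (forall x y, a < x -> x <= y -> y < b -> f x <= f y) ->
  forall y, a < y < b -> l <= f y.
Proof.
move=> fl fi y /andP[ay yb].
apply: cvgr_to_le fl _; near=> x; apply: fi => //.
by near: x; exact: nbhs_right_le.
Unshelve. all: by end_near. Qed.

Lemma at_right_ge_nonincreasing f df a b l :
  f x @[x --> a^'+] --> l ->
  (forall x, a < x < b -> is_derive x 1 f (df x)) ->
  (forall x, a < x < b -> df x <= 0) ->
  forall y, a < y < b -> f y <= l.
Proof.
move=> fl Df df0 y yI.
rewrite -lerN2; apply: (@at_right_le_nondecreasing (- f) a b) => //.
  exact: cvgN.
apply: (@is_derive_nondecreasing _ (fun x => - df x)) => x xI.
  by have ? := Df x xI; exact: is_deriveN.
by rewrite oppr_ge0 df0.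
Qed.

End RealFunctions.

(** * The odd power nonlinearity and its even antiderivative *)

Section Nonlinearity.
Variables (R : realType) (p : R).
Hypothesis p1 : 1 < p.
Implicit Types a b y K : R.

Definition nlin y : R := `|y| `^ (p - 1) * y.
Definition nlin_prim y : R := `|y| `^ (p + 1) / (p + 1).

(* [lra] does not see section hypotheses. *)
Local Ltac plra := have := p1; lra.

Let p0 : 0 < p. Proof. exact: lt_trans p1. Qed.

Lemma nlinN y : nlin (- y) = - nlin y.
Proof. by rewrite /nlin normrN mulrN. Qed.

Lemma nlin_primN y : nlin_prim (- y) = nlin_prim y.
Proof. by rewrite /nlin_prim normrN. Qed.

Lemma norm_nlin y : `|nlin y| = `|y| `^ p.
Proof.
by rewrite /nlin normrM ger0_norm ?powR_ge0// mulrC mulr_powRB1.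
Qed.

Lemma nlin_ge0E y : 0 <= y -> nlin y = y `^ p.
Proof. by move=> y0; rewrite /nlin ger0_norm// mulrC mulr_powRB1. Qed.

Lemma nlinM a y : 0 <= a -> nlin (a * y) = a `^ p * nlin y.
Proof.
move=> a0; rewrite /nlin normrM powRM// (ger0_norm a0) -(mulr_powRB1 a0 p0); ring.
Qed.

Lemma norm_nlin_le K y : `|y| <= K -> `|nlin y| <= K `^ p.
Proof.
move=> yK; rewrite norm_nlin; apply: ge0_ler_powR; rewrite ?nnegrE//.
  exact: ltW.
exact: le_trans yK.
Qed.

Lemma norm_nlin_le1 y : `|y| <= 1 -> `|nlin y| <= 1.
Proof. by move=> /norm_nlin_le; rewrite powR1. Qed.

Let nlin_le_self a : 0 <= a <= 1 -> nlin a <= a.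
Proof.
move=> /andP[a0 a1]; rewrite nlin_ge0E//.
move: a0; rewrite le_eqVlt => /predU1P[<-|a0]; first by rewrite powR0// gt_eqF.
by apply: ge1r_powR; rewrite ?a0// ltW.
Qed.

Let nlin_lip_ge0 a b : 0 <= b -> b <= a -> a <= 1 ->
  0 <= nlin a - nlin b <= p * (a - b).
Proof.
move=> b0 ba a1; have a0 := le_trans b0 ba.
move: b0; rewrite le_eqVlt => /predU1P[<-|b0].
  rewrite [nlin 0]/nlin mulr0 !subr0; apply/andP; split.
    by rewrite nlin_ge0E// powR_ge0.
  apply: le_trans (_ : a <= _); first by rewrite nlin_le_self// a0.
  by rewrite ler_peMl// ltW.
rewrite !nlin_ge0E// ?(ltW b0)//.
have [||c /andP[bc ca] ->] := @MVT_oo R (fun x => x `^ p) (fun x => p * x `^ (p - 1)) 0 2 _ b a b0 ba.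
- by move=> x /andP[x0 _]; exact: is_derive1_powR.
- lra.
have c0 : 0 < c by exact: lt_le_trans bc.
have cp : c `^ (p - 1) <= 1.
  rewrite -[leRHS](powRr0 c); apply: ger_powR; last by rewrite subr_ge0 ltW.
  by rewrite c0 (le_trans ca).
have := powR_ge0 c (p - 1) => cp0.
apply/andP; split.
  by rewrite !mulr_ge0 ?subr_ge0// ltW.
by rewrite ler_wpM2r ?subr_ge0// ler_piMr// ltW.
Qed.

(** On [[-1, 1]] the derivative is at most [p]. The mean value theorem is used at positive arguments
    only, where the power rule holds; oddness transfers the bound to negative ones, and for opposite
    signs [|nlin y| <= |y|] already gives the constant 1. *)
Lemma nlin_lipschitz a b : `|a| <= 1 -> `|b| <= 1 ->
  `|nlin a - nlin b| <= p * `|a - b|.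
Proof.
suff main (c d : R) : `|c| <= 1 -> `|d| <= 1 -> d <= c ->
    `|nlin c - nlin d| <= p * `|c - d|.
  move=> a1 b1; have [ba|/ltW ab] := leP b a; first exact: main.
  by rewrite distrC (distrC a); exact: main.
rewrite ler_norml => /andP[c1 c2]; rewrite ler_norml => /andP[d1 d2] dc.
rewrite (ger0_norm (_ : 0 <= c - d)) ?subr_ge0//.
have [d0|d0] := leP 0 d.
  have /andP[h1 h2] := nlin_lip_ge0 d0 dc c2; by rewrite ger0_norm.
have [c0|c0] := leP 0 c.
  have h1 : 0 <= nlin c <= c.
    by rewrite nlin_le_self ?c0// nlin_ge0E// powR_ge0.
  have h2 : 0 <= nlin (- d) <= - d.
    have d0' : 0 <= - d by rewrite oppr_ge0 ltW.
    rewrite nlin_le_self ?d0' ?nlin_ge0E ?powR_ge0//=; lra.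
  rewrite nlinN in h2.
  rewrite ger0_norm; last lra.
  by apply: (@le_trans _ _ (1 * (c - d))); [lra | rewrite ler_wpM2r ?subr_ge0// ltW].
have : 0 <= nlin (- d) - nlin (- c) <= p * (- d - - c).
  apply: nlin_lip_ge0; lra.
rewrite !nlinN => /andP[h1 h2]; rewrite ger0_norm; lra.
Qed.

Lemma nlin_prim_ge0 y : 0 <= nlin_prim y.
Proof. rewrite /nlin_prim mulr_ge0 ?powR_ge0// invr_ge0; plra. Qed.

Lemma nlin_prim_gt0 y : y != 0 -> 0 < nlin_prim y.
Proof.
move=> y0; rewrite /nlin_prim mulr_gt0 ?powR_gt0 ?normr_gt0// invr_gt0; plra.
Qed.

Lemma nlin_prim_le a b : `|a| <= b -> nlin_prim a <= nlin_prim b.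
Proof.
move=> ab; have b0 := le_trans (normr_ge0 a) ab.
rewrite /nlin_prim ler_wpM2r//; first by rewrite invr_ge0; plra.
rewrite (ger0_norm b0) ge0_ler_powR ?nnegrE//; plra.
Qed.

Lemma nlin_prim_lt a b : 0 <= b -> b < `|a| -> nlin_prim b < nlin_prim a.
Proof.
move=> b0 ab; rewrite /nlin_prim ltr_pM2r; last by rewrite invr_gt0; plra.
rewrite (ger0_norm b0) gt0_ltr_powR ?nnegrE//; plra.
Qed.

(** A crude linear bound, which makes the potential part of the energy small when [y] is small
    without inverting a power. *)
Lemma nlin_prim_le_norm y : `|y| <= 1 -> nlin_prim y <= `|y|.
Proof.
have [->|y0 y1] := eqVneq y 0.
  by rewrite /nlin_prim normr0 powR0 ?mul0r// gt_eqF//; plra.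
rewrite /nlin_prim ler_pdivrMr; last plra.
apply: (@le_trans _ _ `|y|); first by apply: ge1r_powR; rewrite ?normr_gt0 ?y0//; plra.
by rewrite ler_peMr//; plra.
Qed.

(** The power rule covers positive arguments and parity the negative ones. At the origin the
    difference quotient is exactly [nlin z / (p + 1)], which is at most [|z|] in absolute value near
    0. *)
Lemma is_derive_nlin_prim y : is_derive y 1 nlin_prim (nlin y).
Proof.
have pos (x : R) : 0 < x -> is_derive x 1 nlin_prim (nlin x).
  move=> x0.
  have D : is_derive x 1 (fun z : R => z `^ (p + 1) * (p + 1)^-1) (nlin x).
    have ? := is_derive1_powR (p + 1) x0.
    have := @is_deriveM _ _ (fun z : R => z `^ (p + 1)) (cst (p + 1)^-1) x 1 _ _ _ _.
    move=> h; apply: is_derive_eq; rewrite nlin_ge0E ?ltW//= scaler0 add0r.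
    rewrite addrK /GRing.scale /=; field; plra.
  apply: (@near_eq_is_derive _ _ _ _ _ _ _ _ _ D).
  near=> z; rewrite /nlin_prim ger0_norm//.
  by near: z; apply: filterS (lt_nbhsr x0) => z /ltW.
have [y0|y0|->] := ltgtP y 0; last 2 first.
- exact: pos.
- apply/is_derive1_caratheodory; exists (fun z => nlin z / (p + 1)); split.
  + move=> z; rewrite {2}/nlin_prim normr0 powR0 ?mul0r ?subr0; last plra.
    rewrite /nlin_prim /nlin ?subr0.
    have -> : `|z| `^ (p - 1) * z / (p + 1) * z = `|z| `^ (p - 1) * z ^+ 2 / (p + 1).
      by rewrite expr2; ring.
    rewrite -(real_normK (num_real z)).
    rewrite (_ : p + 1 = (p - 1) + 2); last plra.
    rewrite powRD; last by apply/implyP => /eqP; plra.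
    by rewrite (powR_mulrn 2%N).
  + rewrite /prop_for /continuous_at /= (_ : nlin 0 = 0); last by rewrite /nlin mulr0.
    rewrite mul0r.
    apply/cvgrPdist_lt => e e0; near=> z.
    have z1 : `|z| < 1.
      by near: z; apply: (@cvgr0_norm_lt _ _ _ _ _ id) => //; exact: cvg_id.
    have ze : `|z| < e.
      by near: z; apply: (@cvgr0_norm_lt _ _ _ _ _ id) => //; exact: cvg_id.
    rewrite sub0r normrN normrM norm_nlin; apply: le_lt_trans ze.
    have [->|z0] := eqVneq z 0; first by rewrite normr0 powR0 ?mul0r// gt_eqF.
    apply: (@le_trans _ _ (`|z| `^ p)).
      rewrite ler_piMr ?powR_ge0// normfV invf_le1 ger0_norm; plra.
    by apply: ge1r_powR; rewrite ?normr_gt0 ?z0 ltW.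
  + by rewrite /nlin mulr0 mul0r.
- have h : is_derive (- y) 1 nlin_prim (nlin (- y)) by apply: pos; rewrite oppr_gt0.
  have := @is_derive1_comp _ nlin_prim -%R y _ _ h (is_deriveNid _ _).
  rewrite nlinN mulrNN mulr1; congr is_derive.
  by apply/funext => z /=; rewrite nlin_primN.
Unshelve. all: by end_near. Qed.
End Nonlinearity.

(** * The Emden equation *)

Section EmdenEquation.
Variable R : realType.
Implicit Types (p d rho a b s : R) (y dy : R -> R).

(** The initial slope is prescribed only through [s * dy s -> 0], the form that the change of
    variables delivers directly; [dy s -> 0] is derived from it. The equation holds in the open
    interval, and only [y] itself is continuous up to both ends. *)
Record emden p d rho y dy : Prop := Emden {
  emden_gt0 : 0 < rho;
  emden_y0 : y 0 = 1;
  emden_yrho : y rho = 0;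
  emden_cont : {within `[0, rho], continuous y};
  emden_dy : forall s, 0 < s < rho -> is_derive s 1 y (dy s);
  emden_ddy : forall s, 0 < s < rho ->
    is_derive s 1 dy (- ((1 + d) / s * dy s + nlin p (y s)));
  emden_flux : s * dy s @[s --> 0^'+] --> 0 }.

(* [s `^ (1 + d) * (z s + G * s)] is nondecreasing and vanishes at the origin. *)
Lemma damped_ge (d b G : R) (z n : R -> R) : 0 <= d ->
  (forall s, 0 < s < b -> is_derive s 1 z (- ((1 + d) / s * z s + n s))) ->
  s * z s @[s --> 0^'+] --> 0 ->
  (forall s, 0 < s < b -> n s <= G) -> 0 <= G ->
  forall s, 0 < s < b -> - (G * s) <= z s.
Proof.
move=> d0 Dz z0 nG G0 s sb; have /andP[s0 _] := sb.
pose h s := s `^ (1 + d) * (z s + G * s).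
have pd x : 0 < x -> x `^ (1 + d) = x * x `^ d.
  by move=> x0; rewrite powRD ?powRr1 ?ltW// (gt_eqF x0) implybT.
suff : 0 <= h s by rewrite pmulr_rge0 ?powR_gt0// => ?; lra.
apply: (@at_right_le_nondecreasing _ h 0 b) => //; last first.
  apply: (@is_derive_nondecreasing _ h (fun x => (1 + d) * x `^ d * (z x + G * x)
    + x `^ (1 + d) * (- ((1 + d) / x * z x + n x) + G))) => x xb; have /andP[x0 _] := xb.
    have D1 := is_derive1_powR (1 + d) x0.
    have D2 := Dz x xb.
    apply: is_derive_eq; rewrite /GRing.scale /= (addrC 1 d) addrK; ring.
  rewrite pd//.
  rewrite [leRHS](_ : _ = x `^ d * x * ((1 + d) * G + (G - n x))).
    rewrite mulr_ge0 ?mulr_ge0 ?powR_ge0 ?(ltW x0)//.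
    by rewrite addr_ge0 ?subr_ge0 ?nG ?mulr_ge0//; lra.
  by field; rewrite gt_eqF.
have k0 : x * z x + G * x ^+ 2 @[x --> 0^'+] --> 0.
  rewrite -[X in _ --> X](addr0 0); apply: cvgD => //.
  rewrite -[X in _ --> X](mulr0 G); apply: cvgMr; apply: cvg_at_right_filter.
  by rewrite -[X in _ --> X](expr0n R 2); apply: exprn_continuous.
apply/cvgrPdist_lt => e e0; near=> x.
have x0 : 0 < x by [].
have x1 : x <= 1 by near: x; apply: nbhs_right_le; exact: ltr01.
rewrite sub0r normrN /h pd// mulrAC mulrC normrM.
rewrite (_ : x * _ = x * z x + G * x ^+ 2); last by rewrite expr2; ring.
apply: (@le_lt_trans _ _ `|x * z x + G * x ^+ 2|).
  rewrite ler_piMl// ger0_norm ?powR_ge0//.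
  by rewrite -[leRHS](powRr0 x); apply: ger_powR; rewrite ?x0.
by near: x; exact: cvgr0_norm_lt.
Unshelve. all: by end_near. Qed.

(** * A priori bounds, uniform in [d] *)

Section Bounds.
Variables (p d rho : R) (y dy : R -> R).
Hypotheses (p1 : 1 < p) (d0 : 0 <= d) (d1 : d <= 1) (ysol : emden p d rho y dy).

(** One-sided damping applied to [dy] and to [- dy]. It serves twice: near the origin with
    [G = 2 ^ p], where continuity gives [|y| <= 2], and on the whole interval with [G = 1], once the
    energy has given [|y| <= 1]. *)
Lemma emden_flux_bound b G : b <= rho -> 0 <= G ->
  (forall s, 0 < s < b -> `|nlin p (y s)| <= G) ->
  forall s, 0 < s < b -> `|dy s| <= G * s.
Proof.
move=> br G0 nG s sb.
have sub x : 0 < x < b -> 0 < x < rho.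
  by move=> /andP[-> /lt_le_trans]; exact.
rewrite ler_norml; apply/andP; split.
  apply: (@damped_ge d b G dy (fun x => nlin p (y x))) => //.
  - by move=> x /sub; exact: emden_ddy.
  - exact: emden_flux ysol.
  - by move=> x xb; apply: le_trans (nG x xb); exact: ler_norm.
rewrite -lerN2; apply: (@damped_ge d b G (- dy) (fun x => - nlin p (y x))) => //.
- move=> x /sub xr; have := emden_ddy ysol xr => D.
  apply: is_derive_eq; rewrite (_ : (- dy) x = - dy x ) //; ring.
- rewrite -[X in _ --> X]oppr0 (_ : (fun x => _) = - (fun x => x * dy x)); first by apply: cvgN; exact: emden_flux ysol.
  by apply/funext => x /=; rewrite mulrN.
- by move=> x xb; apply: le_trans (nG x xb); rewrite ler_normr lexx orbT.
Qed.

Lemma emden_cvg0 : y s @[s --> 0^'+] --> (1 : R).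
Proof.
have [_ + _] := (continuous_within_itvP y (emden_gt0 ysol)).1 (emden_cont ysol).
by rewrite (emden_y0 ysol).
Qed.

Lemma emden_dy_cvg0 : dy s @[s --> 0^'+] --> (0 : R).
Proof.
have [b [b0 br yb]] : exists b, [/\ 0 < b, b <= rho & forall s, 0 < s < b -> `|y s| <= 2].
  have : \forall s \near 0^'+, `|y s| <= 2.
    apply: (cvgr_norm_le _ emden_cvg0); rewrite normr1; lra.
  move=> [e /= e0 he]; exists (Num.min e rho); split.
  - by rewrite lt_min e0 (emden_gt0 ysol).
  - by rewrite ge_min lexx orbT.
  move=> s /andP[s0]; rewrite lt_min => /andP[se _]; apply: he => //=.
  by rewrite sub0r normrN gtr0_norm.
have dyb := @emden_flux_bound b (2 `^ p) br (powR_ge0 _ _)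
  (fun s sb => norm_nlin_le p1 (yb s sb)).
apply/cvgrPdist_lt => e e0; near=> s.
have s0 : 0 < s by [].
have G0 : 0 < 2 `^ p :> R by rewrite powR_gt0.
rewrite sub0r normrN; apply: (@le_lt_trans _ _ (2 `^ p * s)).
  by apply: dyb; rewrite s0/=; near: s; exact: nbhs_right_lt.
rewrite mulrC -ltr_pdivlMr//; near: s; apply: nbhs_right_lt; exact: divr_gt0.
Unshelve. all: by end_near. Qed.

Definition energy s := dy s ^+ 2 / 2 + nlin_prim p (y s).

Lemma is_derive_energy s : 0 < s < rho ->
  is_derive s 1 energy (- ((1 + d) / s * dy s ^+ 2)).
Proof.
move=> sr; have D1 := emden_dy ysol sr; have D2 := emden_ddy ysol sr.
have D3 := is_derive1_comp (is_derive_nlin_prim p1 (y s)) D1.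
have D4 : is_derive s 1 (fun x => dy x ^+ 2 / 2) (- (dy s * ((1 + d) / s * dy s + nlin p (y s)))).
  apply: is_derive_eq; rewrite /GRing.scale /=; field.
  by case/andP: sr => s0 _; rewrite gt_eqF.
rewrite (_ : energy = (fun x => dy x ^+ 2 / 2) + (nlin_prim p \o y))//.
apply: is_derive_eq; ring.
Qed.

Lemma energy_nonincreasing a b : 0 < a -> a <= b -> b < rho -> energy b <= energy a.
Proof.
move=> a0 ab br; rewrite -lerN2.
apply: (@is_derive_nondecreasing _ (- energy) (fun s => (1 + d) / s * dy s ^+ 2) 0 rho) => //.
  move=> x xr; have D := is_derive_energy xr.
  by apply: is_derive_eq; rewrite opprK.
move=> x /andP[x0 _]; rewrite mulr_ge0 ?sqr_ge0// divr_ge0 ?ltW//.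
by have := d0; lra.
Qed.

(** The energy decreases from its limit [nlin_prim p 1] at the origin, where [y] tends to 1 and [dy]
    to 0; a value with [|y s| > 1] would exceed it. *)
Lemma norm_emden_le1 s : 0 < s < rho -> `|y s| <= 1.
Proof.
move=> sr.
have E1 : energy s <= nlin_prim p 1.
  apply: (at_right_ge_nonincreasing _ is_derive_energy _ sr); last first.
    move=> x /andP[x0 _]; rewrite oppr_le0 mulr_ge0 ?sqr_ge0// divr_ge0 ?ltW//.
    by have := d0; lra.
  rewrite -[X in _ --> X]add0r; apply: cvgD.
    rewrite -[X in _ --> X](mul0r 2^-1); apply: cvgMl.
    rewrite -[X in _ --> X](mulr0 0); exact: (cvgM emden_dy_cvg0 emden_dy_cvg0).
  apply: continuous_cvg; last exact: emden_cvg0.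
  apply/differentiable_continuous/derivable1_diffP.
  by have [] := is_derive_nlin_prim p1 (1 : R).
have [//|y1] := leP `|y s| 1.
have := nlin_prim_lt p1 ler01 y1; move: E1; rewrite /energy.
by have := sqr_ge0 (dy s); lra.
Qed.

Lemma norm_dy_le s : 0 < s < rho -> `|dy s| <= s.
Proof.
move=> sr; rewrite -[leRHS]mul1r.
apply: (@emden_flux_bound rho 1) sr => // x xr.
by apply: norm_nlin_le1 => //; exact: norm_emden_le1.
Qed.

(** The damping term is at most [1 + d <= 2] because [|dy s| <= s], and the nonlinear term is at
    most 1. *)
Lemma norm_ddy_le s : 0 < s < rho ->
  `|- ((1 + d) / s * dy s + nlin p (y s))| <= 3.
Proof.
move=> sr; have := norm_dy_le sr; have /andP[s0 _] := sr.
have h1 := norm_nlin_le1 p1 (norm_emden_le1 sr).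
rewrite normrN => h2; apply: le_trans (ler_normD _ _) _.
suff : `|(1 + d) / s * dy s| <= 1 + d by move=> h3; have := d1; lra.
have d' : 0 <= 1 + d by have := d0; lra.
rewrite -mulrA normrM ger0_norm// ler_piMr// normrM gtr0_norm ?invr_gt0//.
by rewrite mulrC ler_pdivrMr// mul1r.
Qed.

Lemma emden_lipschitz B a b : 0 <= a -> a <= b -> b <= rho -> b <= B ->
  `|y b - y a| <= B * (b - a).
Proof.
move=> a0 ab br bB.
have [<-|anb] := eqVneq a b; first by rewrite !subrr normr0 mulr0.
have ab' : a < b by rewrite lt_neqAle anb.
have [||c] := @MVT R y dy a b ab'.
- move=> x; rewrite in_itv /= => /andP[ax xb]; apply: emden_dy ysol _ _.
  by rewrite (le_lt_trans a0 ax) (lt_le_trans xb br).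
- apply: continuous_subspaceW (emden_cont ysol) => x /=.
  by rewrite !in_itv/= => /andP[ax xb]; rewrite (le_trans a0 ax) (le_trans xb br).
rewrite in_itv /= => /andP[ac cb] ->.
have cr : 0 < c < rho by rewrite (le_lt_trans a0 ac) (lt_le_trans cb br).
rewrite normrM (gtr0_norm (_ : 0 < b - a)) ?subr_gt0//.
rewrite ler_wpM2r ?subr_ge0//.
by apply: le_trans (norm_dy_le cr) _; apply: le_trans bB; exact: ltW.
Qed.

(** On [[0, s]] the Lipschitz constant is [s] itself, hence the square. This puts every zero at
    distance at least 1 from the origin and gives [y (1 / 2) >= 3 / 4]. *)
Lemma emden_near1 s : 0 <= s <= rho -> 1 - s ^+ 2 <= y s.
Proof.
move=> /andP[s0 sr]; have := @emden_lipschitz s 0 s (lexx _) s0 sr (lexx _).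
by rewrite (emden_y0 ysol) subr0 ler_norml expr2 => /andP[+ _]; lra.
Qed.

Lemma emden_rho_ge1 : 1 <= rho.
Proof.
have := @emden_near1 rho; rewrite lexx (emden_yrho ysol) ltW ?(emden_gt0 ysol)//.
move=> /(_ isT) h; rewrite -(ler_pXn2r (_ : 0 < 2)%N) ?nnegrE ?ler01 ?(ltW (emden_gt0 ysol))//.
by rewrite expr1n; lra.
Qed.

(** The exponent 4 beats the damping: [4 * energy >= 2 * dy ^ 2 >= (1 + d) * dy ^ 2] when [d <= 1].
    It limits how fast the energy can decay. *)
Lemma energy_weighted_nondecreasing a b : 0 < a -> a <= b -> b < rho ->
  a ^+ 4 * energy a <= b ^+ 4 * energy b.
Proof.
apply: (@is_derive_nondecreasing _ (fun s => s ^+ 4 * energy s) (fun s =>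
   s ^+ 3 * (4 * energy s - (1 + d) * dy s ^+ 2)) 0 rho) => s sr; have /andP[s0 _] := sr.
  have D := is_derive_energy sr.
  apply: is_derive_eq; rewrite /GRing.scale /=; field.
  by rewrite gt_eqF.
apply: mulr_ge0; first by rewrite exprn_ge0// ltW.
have := nlin_prim_ge0 p1 (y s); rewrite /energy => h.
have : d * dy s ^+ 2 <= dy s ^+ 2 by rewrite ler_piMl ?sqr_ge0.
by have := sqr_ge0 (dy s); lra.
Qed.

End Bounds.
End EmdenEquation.

Section EmdenZeros.
Variable R : realType.
Implicit Types (p d rho a b s : R) (y dy : R -> R).

(** The energy has a lower bound on [(0, B]] independent of [d], so a small potential part forces a
    large kinetic part. One constant [c] serves as threshold for both. *)
Lemma emden_nondegenerate p (B : R) : 1 < p -> 1 <= B ->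
  exists c, [/\ 0 < c, c <= 1 & forall d rho y dy, 0 <= d -> d <= 1 ->
    emden p d rho y dy ->
    forall s, 0 < s < rho -> s <= B -> `|y s| <= c -> c <= `|dy s|].
Proof.
move=> p1 B1.
(* [q] bounds the energy at [1 / 2] from below. Before [1 / 2] the energy is larger; after it, the
   weight [s ^ 4] costs the factor [(1 / 2) ^ 4 / B ^ 4], which gives [e0]. *)
pose q := nlin_prim p (3 / 4 : R); pose e0 := q / (16 * B ^+ 4).
have q0 : 0 < q by apply: nlin_prim_gt0 => //; rewrite gt_eqF//; lra.
have B40 : 1 <= B ^+ 4 by rewrite exprn_ege1.
have e00 : 0 < e0 by rewrite /e0 divr_gt0//; lra.
have e0q : e0 * (16 * B ^+ 4) = q by rewrite /e0 divfK// gt_eqF//; lra.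
exists (Num.min 1 (e0 / 2)); split.
- by rewrite lt_min ltr01 divr_gt0.
- by rewrite ge_min lexx.
move=> d rho y dy d0 d1 ysol s sr sB; rewrite le_min => /andP[y1 ye].
have /andP[s0 srho] := sr.
have r1 := emden_rho_ge1 p1 d0 ysol.
have h12 : 0 < (1 / 2 : R) < rho by apply/andP; split; lra.
have E12 : q <= energy p y dy (1 / 2).
  have : q <= nlin_prim p (y (1 / 2)).
    have h : 3 / 4 <= y (1 / 2).
      have := @emden_near1 _ _ _ _ _ _ p1 d0 ysol (1 / 2).
      have -> : 0 <= (1 / 2 : R) <= rho by apply/andP; split; lra.
      by move=> /(_ isT); rewrite expr2; lra.
    have := @nlin_prim_le _ _ p1 (3 / 4) (y (1 / 2)); apply.
    by rewrite ger0_norm; lra.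
  by rewrite /energy; have := sqr_ge0 (dy (1 / 2)); lra.
have E0 : e0 <= energy p y dy s.
  have [s12|s12] := leP s (1 / 2).
    have := energy_nonincreasing p1 d0 ysol s0 s12; case/andP: h12 => _ h /(_ h).
    suff : e0 <= q by lra.
    by rewrite -e0q ler_peMr//; [exact: ltW | lra].
  have := energy_weighted_nondecreasing p1 d1 ysol (_ : 0 < 1 / 2) (ltW s12) srho.
  move=> /(_ _)/wrap[]; first lra.
  have h1 : 0 <= energy p y dy s.
    by rewrite addr_ge0 ?nlin_prim_ge0// divr_ge0 ?sqr_ge0.
  have h2 : s ^+ 4 * energy p y dy s <= B ^+ 4 * energy p y dy s.
    by rewrite ler_wpM2r// lerXn2r ?nnegrE//; lra.
  have -> : (1 / 2 : R) ^+ 4 = 1 / 16 by field.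
  move=> h3.
  rewrite -(ler_pM2l (_ : 0 < B ^+ 4)); last lra.
  have -> : B ^+ 4 * e0 = q / 16 by rewrite -e0q; field.
  lra.
have := nlin_prim_le_norm p1 y1; move: E0; rewrite /energy => E0 h.
rewrite -(ler_pXn2r (_ : 0 < 2)%N) ?nnegrE ?normr_ge0//; last first.
  by rewrite le_min ler01/= ltW// divr_gt0.
rewrite real_normK ?num_real//.
set c := Num.min _ _.
have c1 : c <= 1 by rewrite /c ge_min lexx.
have c2 : c <= e0 / 2 by rewrite /c ge_min lexx orbT.
have c0 : 0 <= c by rewrite /c le_min ler01/= ltW// divr_gt0.
have : c ^+ 2 <= c by rewrite expr2 ler_piMl.
lra.
Qed.

(** * Continuous dependence on [d] *)

Section Comparison.
Variables (p d rho rho0 : R) (y dy y0 dy0 : R -> R).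
Hypotheses (p1 : 1 < p) (d0 : 0 <= d).
Hypotheses (ysol : emden p d rho y dy) (y0sol : emden p 0 rho0 y0 dy0).

Let F s := (y s - y0 s) ^+ 2 + (dy s - dy0 s) ^+ 2.

(* [(F s + d ^+ 2) * expR (- (2 + p) * s)] is nonincreasing, with limit [d ^+ 2]
   at the origin. *)
Let emden_gronwall s : 0 < s < Num.min rho rho0 ->
  F s <= d ^+ 2 * expR ((2 + p) * s).
Proof.
move=> sr.
pose ex s := expR (- ((2 + p) * s)) : R.
pose DF s := 2 * (y s - y0 s) * (dy s - dy0 s)
  + 2 * (dy s - dy0 s) * (- ((1 + d) / s * dy s + nlin p (y s))
                       + ((1 + 0) / s * dy0 s + nlin p (y0 s))).
pose G s := (F s + d ^+ 2) * ex s.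
suff : G s <= d ^+ 2.
  rewrite /G /ex expRN -ler_pdivlMr ?invr_gt0 ?expR_gt0// invrK.
  by have := sqr_ge0 d; lra.
apply: (@at_right_ge_nonincreasing _ G
    (fun s => (DF s - (2 + p) * (F s + d ^+ 2)) * ex s) 0 (Num.min rho rho0)) sr.
- rewrite -[X in _ --> X]mulr1; apply: cvgM.
    rewrite -[X in _ --> X]add0r; apply: cvgD; last exact: cvg_cst.
    have hD : y s - y0 s @[s --> 0^'+] --> (0 : R).
      rewrite -[X in _ --> X](subrr 1).
      exact: cvgB (emden_cvg0 ysol) (emden_cvg0 y0sol).
    have hdD : dy s - dy0 s @[s --> 0^'+] --> (0 : R).
      rewrite -[X in _ --> X](subrr 0).
      exact: cvgB (emden_dy_cvg0 p1 d0 ysol) (emden_dy_cvg0 p1 (lexx 0) y0sol).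
    rewrite -[X in _ --> X](addr0 0); apply: cvgD.
      by rewrite -[X in _ --> X](mulr0 0); exact: (cvgM hD hD).
    by rewrite -[X in _ --> X](mulr0 0); exact: (cvgM hdD hdD).
  apply: cvg_at_right_filter.
  rewrite [X in _ --> X](_ : 1 = ex 0); last by rewrite /ex mulr0 oppr0 expR0.
  have cex : {for 0, continuous (expR \o (fun s : R => - ((2 + p) * s)))}.
    apply: continuous_comp; last exact: continuous_expR.
    by apply: cvgN; exact: mulrl_continuous.
  exact: cex.
- move=> x /andP[x0]; rewrite lt_min => /andP[xr xr0].
  have xr' : 0 < x < rho by rewrite x0.
  have xr0' : 0 < x < rho0 by rewrite x0.
  have D1 := emden_dy ysol xr'; have D2 := emden_ddy ysol xr'.
  have D3 := emden_dy y0sol xr0'; have D4 := emden_ddy y0sol xr0'.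
  apply: is_derive_eq; rewrite /DF /F /GRing.scale /=.
  set g1 := nlin p (y x); set g0 := nlin p (y0 x).
  rewrite /ex; ring.
- move=> x /andP[x0]; rewrite lt_min => /andP[xr xr0].
  have xr' : 0 < x < rho by rewrite x0.
  have xr0' : 0 < x < rho0 by rewrite x0.
  rewrite mulr_le0_ge0 ?expR_ge0// subr_le0 /DF /F.
  have y1 := norm_emden_le1 p1 d0 ysol xr'.
  have y01 := norm_emden_le1 p1 (lexx 0) y0sol xr0'.
  have gl := nlin_lipschitz p1 y1 y01.
  have q1 : `|dy x / x| <= 1.
    rewrite normrM normfV (gtr0_norm x0) ler_pdivrMr// mul1r.
    exact: norm_dy_le ysol _ xr'.
  (* The equations are subtracted so that the singular coefficient [1 / x] falls on the difference
     of slopes, where it damps, while [d] multiplies only the bounded quotient [dy x / x]. *)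
  have -> : - ((1 + d) / x * dy x + nlin p (y x)) +
      ((1 + 0) / x * dy0 x + nlin p (y0 x)) =
      - ((dy x - dy0 x) / x) - d * (dy x / x) - (nlin p (y x) - nlin p (y0 x)) by ring.
  move: gl q1.
  (* With [D] and [E] the differences of values and slopes: [2DE <= D^2 + E^2], the term in
     [E^2 / x] is dropped, [-2Edq <= E^2 + d^2], and the Lipschitz bound gives
     [-2Eg <= p (D^2 + E^2)]. The sum is at most [(2 + p) (F + d^2)]. *)
  move: (nlin p _ - _) (dy x / x) (y x - y0 x) (dy x - dy0 x) => g q D E gl q1.
  have h1 : 0 <= (D - E) ^+ 2 by exact: sqr_ge0.
  have h2 : 0 <= E ^+ 2 / x by rewrite divr_ge0 ?sqr_ge0 ?ltW.
  have h3 : 0 <= (E + d * q) ^+ 2 by exact: sqr_ge0.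
  have h4 : d ^+ 2 * q ^+ 2 <= d ^+ 2.
    by rewrite ler_piMr ?sqr_ge0// -(real_normK (num_real q)) expr_le1.
  have h5 : - (2 * E * g) <= p * (E ^+ 2 + D ^+ 2).
    apply: le_trans (ler_norm _) _.
    rewrite normrN !normrM (ger0_norm (_ : 0 <= 2))//.
    apply: (@le_trans _ _ (2 * `|E| * (p * `|D|))).
      by rewrite ler_wpM2l// mulr_ge0.
    rewrite -(real_normK (num_real E)) -(real_normK (num_real D)).
    have p0 : 0 <= p by have := p1 => ?; lra.
    have : 0 <= p * (`|E| - `|D|) ^+ 2 by rewrite mulr_ge0 ?sqr_ge0.
    rewrite !expr2; lra.
  have h6 : 0 <= p * d ^+ 2 by rewrite mulr_ge0 ?sqr_ge0//; have := p1 => ?; lra.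
  have := sqr_ge0 d.
  move: h1 h2 h3 h4 h5; rewrite !expr2 => h1 h2 h3 h4 h5 h7.
  have -> : 2 * D * E + 2 * E * (- (E / x) - d * q - g) =
     2 * D * E - 2 * (E * E / x) - 2 * E * (d * q) - 2 * E * g by ring.
  by move: h6 (sqr_ge0 D); rewrite !expr2 => h6 h8; lra.
Qed.

(** The factor [expR ((2 + p) * B)] is at least 1, so it may be replaced by its square; this avoids
    a square root in the bound. *)
Lemma emden_compare B s : 0 < s < Num.min rho rho0 -> s <= B ->
  `|y s - y0 s| <= expR ((2 + p) * B) * d /\
  `|dy s - dy0 s| <= expR ((2 + p) * B) * d.
Proof.
move=> sr sB; have /andP[s0 _] := sr.
have M1 : 1 <= expR ((2 + p) * B).
  rewrite -[leLHS]expR0 ler_expR mulr_ge0 ?(le_trans (ltW s0) sB)//.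
  by have := p1 => ?; lra.
have FM : F s <= (expR ((2 + p) * B) * d) ^+ 2.
  apply: le_trans (emden_gronwall sr) _.
  rewrite exprMn mulrC ler_wpM2r ?sqr_ge0//.
  apply: (@le_trans _ _ (expR ((2 + p) * B))).
    by rewrite ler_expR ler_wpM2l//; have := p1 => ?; lra.
  by rewrite expr2 ler_peMl// (le_trans ler01).
have Md : 0 <= expR ((2 + p) * B) * d by rewrite mulr_ge0 ?expR_ge0.
by move: FM; rewrite /F => FM; split;
  rewrite -(ler_pXn2r (_ : 0 < 2)%N) ?nnegrE// real_normK ?num_real//;
  apply: le_trans FM; rewrite (lerDl, lerDr) sqr_ge0.
Qed.

(** Endpoints are reached by stepping back [h] into the open interval; the Lipschitz bounds of the
    two solutions cost [2 * B * h], which is at most the slack [e]. *)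
Lemma emden_compare_closed B s : 0 < s -> s <= rho -> s <= rho0 -> s <= B ->
  `|y s - y0 s| <= expR ((2 + p) * B) * d.
Proof.
move=> s0 sr sr0 sB; apply/ler_addgt0Pr => e e0.
have B0 : 0 < B by exact: lt_le_trans sB.
pose h := Num.min (s / 2) (e / (2 * B)).
have h0 : 0 < h by rewrite lt_min !divr_gt0// mulr_gt0.
have hs : h <= s / 2 by rewrite ge_min lexx.
have he : 2 * B * h <= e by rewrite mulrC -ler_pdivlMr ?mulr_gt0// ge_min lexx orbT.
have xI : 0 < s - h < Num.min rho rho0.
  by rewrite lt_min; apply/andP; split; [lra|apply/andP; split; lra].
have hB : s - h <= B by lra.
have sh0 : 0 <= s - h by lra.
have shs : s - h <= s by lra.
have [c1 _] := emden_compare xI hB.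
have := emden_lipschitz p1 d0 ysol sh0 shs sr sB.
have := emden_lipschitz p1 (lexx 0) y0sol sh0 shs sr0 sB.
rewrite (_ : B * (s - (s - h)) = B * h); last by ring.
move: c1; rewrite !ler_norml => /andP[? ?] /andP[? ?] /andP[? ?].
by apply/andP; split; lra.
Qed.

End Comparison.
End EmdenZeros.

(** * Stability of zeros *)

Section ZeroConvergence.
Variable R : realType.
Implicit Types (p d rho a b s : R) (y dy : R -> R).

(** Within distance [t] of [a] the slope changes by at most [c / 2], so it keeps its sign and size
    [c / 2]. A change of [c * t / 2] on either side outweighs [|z a|], and the intermediate value
    theorem applies. *)
Lemma transversal_zero (A B a t c K : R) (z dz ddz : R -> R) :
  (forall x, A < x < B -> is_derive x 1 z (dz x)) ->
  (forall x, A < x < B -> is_derive x 1 dz (ddz x)) ->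
  (forall x, A < x < B -> `|ddz x| <= K) ->
  A < a - t -> a + t < B -> 0 < t -> K * t <= c / 2 ->
  `|z a| <= c * t / 2 -> c <= `|dz a| ->
  exists2 s, a - t <= s <= a + t & z s = 0.
Proof.
move=> D1 D2 K2 At tB t0 Kt za ca.
wlog dza : z dz ddz D1 D2 K2 za ca / 0 <= dz a.
  move=> W; have [/W|dza] := leP 0 (dz a); first exact.
  have [||||||s sI] := W (- z) (- dz) (- ddz).
  - by move=> x /D1 ?; exact: is_deriveN.
  - by move=> x /D2 ?; exact: is_deriveN.
  - by move=> x xI; rewrite /= normrN K2.
  - by rewrite /= normrN.
  - by rewrite /= normrN.
  - by rewrite oppr_ge0 ltW.
  - by move/eqP; rewrite oppr_eq0 => /eqP z0; exists s.
rewrite ger0_norm// in ca.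
have dzc x : a - t <= x <= a + t -> c / 2 <= dz x.
  move=> /andP[ax xt].
  suff : `|dz x - dz a| <= K * t by rewrite ler_norml => /andP[? _]; lra.
  have lip u v : a - t <= u -> u <= v -> v <= a + t -> v - u <= t -> `|dz v - dz u| <= K * t.
    move=> au uv va vut.
    have [|||e /andP[ue ev] ->] := @MVT_oo _ _ _ _ _ D2 u v; [lra|lra|lra|].
    rewrite normrM (ger0_norm (_ : 0 <= v - u)) ?subr_ge0//.
    rewrite ler_pM ?subr_ge0//; apply: K2; apply/andP; split; lra.
  have [xa|/ltW xa] := leP x a; last by apply: lip; lra.
  by rewrite distrC; apply: lip; lra.
have z1 : 0 <= z (a + t).
  have [|||e /andP[ue ev]] := @MVT_oo _ _ _ _ _ D1 a (a + t); [lra|lra|lra|].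
  have := dzc e; move=> /(_ _)/wrap[]; first by apply/andP; split; lra.
  rewrite (_ : a + t - a = t); last by ring.
  move=> h; have : c / 2 * t <= dz e * t by rewrite ler_wpM2r// ltW.
  move: za; rewrite ler_norml => /andP[? _] ? ?; lra.
have z2 : z (a - t) <= 0.
  have [|||e /andP[ue ev]] := @MVT_oo _ _ _ _ _ D1 (a - t) a; [lra|lra|lra|].
  have := dzc e; move=> /(_ _)/wrap[]; first by apply/andP; split; lra.
  rewrite (_ : a - (a - t) = t); last by ring.
  move=> h; have : c / 2 * t <= dz e * t by rewrite ler_wpM2r// ltW.
  move: za; rewrite ler_norml => /andP[_ ?] ? ?; lra.
have att : a - t <= a + t by lra.
have [||s sI zs] := @IVT R z (a - t) (a + t) 0 att.
- exact: (derivable_continuous_oo D1).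
- by rewrite ge_min le_max z2 z1 orbT.
by exists s => //; move: sI; rewrite in_itv.
Qed.

(** Rolle's theorem gives a critical point between the zeros, and there nondegeneracy excludes a
    small [|y|]. The uniform height yields both the gap between zeros and the lower bound on the
    extrema. *)
Lemma emden_bump p (B : R) : 1 < p -> 1 <= B ->
  exists c, [/\ 0 < c, c <= 1 & forall d rho y dy, 0 <= d -> d <= 1 ->
    emden p d rho y dy ->
    forall a b, 0 < a -> a < b -> b <= rho -> b <= B -> y a = 0 -> y b = 0 ->
    exists2 x, a < x < b & c < `|y x|].
Proof.
move=> p1 B1; have [c [c0 c1 cP]] := emden_nondegenerate p1 B1.
exists c; split => // d rho y dy d0 d1 ysol a b a0 ab br bB ya yb.
have [||x] := @MVT R y dy a b ab.
- move=> x; rewrite in_itv /= => /andP[ax xb]; apply: emden_dy ysol _ _.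
  by rewrite (lt_trans a0 ax) (lt_le_trans xb br).
- apply: continuous_subspaceW (emden_cont ysol) => x /=.
  by rewrite !in_itv/= => /andP[ax xb]; rewrite (le_trans (ltW a0) ax) (le_trans xb br).
rewrite in_itv /= => /andP[ax xb]; rewrite ya yb subrr => /esym/eqP.
rewrite mulf_eq0 subr_eq0 (gt_eqF ab) orbF => /eqP dyx.
have xr : 0 < x < rho by rewrite (lt_trans a0 ax) (lt_le_trans xb br).
exists x; first by rewrite ax.
rewrite ltNge; apply/negP => /(cP _ _ _ _ d0 d1 ysol x xr (ltW (lt_le_trans xb bB))).
by rewrite dyx normr0 leNgt c0.
Qed.

(** Climbing from zero to height [c] with slope at most [B] takes a length of at least [c / B]. *)
Lemma emden_zero_gap p (B : R) : 1 < p -> 1 <= B ->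
  exists2 h, 0 < h & forall d rho y dy, 0 <= d -> d <= 1 -> emden p d rho y dy ->
    forall a b, 0 < a -> a < b -> b <= rho -> b <= B -> y a = 0 -> y b = 0 ->
    h <= b - a.
Proof.
move=> p1 B1; have [c [c0 _ cP]] := emden_bump p1 B1.
have B0 : 0 < B by exact: lt_le_trans B1.
exists (c / B); first exact: divr_gt0.
move=> d rho y dy d0 d1 ysol a b a0 ab br bB ya yb.
have [x /andP[ax xb] yx] := cP _ _ _ _ d0 d1 ysol a b a0 ab br bB ya yb.
have := emden_lipschitz p1 d0 ysol (ltW a0) (ltW ax) (ltW (lt_le_trans xb br))
  (ltW (lt_le_trans xb bB)).
rewrite ya subr0 => h; rewrite ler_pdivrMr// mulrC.
apply: le_trans (ltW yx) (le_trans h _).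
by rewrite ler_wpM2l ?(ltW B0)// lerD2r ltW.
Qed.

Lemma emden_zero_ge1 p d rho y dy s : 1 < p -> 0 <= d -> emden p d rho y dy ->
  0 < s <= rho -> y s = 0 -> 1 <= s.
Proof.
move=> p1 d0 ysol /andP[s0 sr] ys.
have := @emden_near1 _ _ _ _ _ _ p1 d0 ysol s.
rewrite (ltW s0) sr ys => /(_ isT) h.
by rewrite -(ler_pXn2r (_ : 0 < 2)%N) ?nnegrE ?ler01 ?(ltW s0)// expr1n; lra.
Qed.

Section Reference.
Variables (p rho0 : R) (y0 dy0 : R -> R).
Hypotheses (p1 : 1 < p) (y0sol : emden p 0 rho0 y0 dy0).

(** [|y0|] has a positive minimum on the compact interval, and [d] is taken so small that the
    comparison error is at most half of it. *)
Lemma emden_no_zero a b : 0 < a -> b <= rho0 ->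
  (forall s, a <= s <= b -> y0 s != 0) ->
  exists2 e, 0 < e & forall d rho y dy, 0 <= d -> d <= 1 -> d <= e ->
    emden p d rho y dy -> forall s, a <= s <= b -> s <= rho -> y s != 0.
Proof.
move=> a0 br nz; have [ab|ba] := leP a b; last first.
  exists 1 => // d rho y dy _ _ _ _ s /andP[/le_trans h /h]; lra.
have [|c] := @EVT_min R (fun x => `|y0 x|) a b ab.
  apply: (@continuous_subspaceW _ _ _ `[0, rho0]).
    by move=> x /=; rewrite !in_itv/= => /andP[ax xb]; rewrite (le_trans (ltW a0) ax) (le_trans xb br).
  by move=> x; apply: continuous_comp; [exact: emden_cont y0sol x | exact: norm_continuous].
rewrite in_itv/= => cI cP.
have yc : 0 < `|y0 c| by rewrite normr_gt0 nz.
pose M := expR ((2 + p) * rho0) : R.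
have M0 : 0 < M by exact: expR_gt0.
exists (`|y0 c| / (2 * M)); first by rewrite divr_gt0// mulr_gt0.
move=> d rho y dy d0 d1 de ysol s sI sr; have /andP[as_ sb] := sI.
have s0 := lt_le_trans a0 as_.
have := emden_compare_closed p1 d0 ysol y0sol s0 sr (le_trans sb br) (le_trans sb br).
rewrite -/M => h; apply/negP => /eqP ys; move: h; rewrite ys sub0r normrN.
have := cP s; rewrite in_itv/= => /(_ sI) h1 h2.
move: de; rewrite ler_pdivlMr ?mulr_gt0// => h3.
lra.
Qed.

(** Since [sg] may equal [rho0], where the reference solution stops, the two solutions are compared
    at [sg - tau], strictly inside the domain. The assumption [sg - eps < rho] rules out a solution
    that ends too early. *)
Lemma emden_zero_near sg eps : 0 < sg <= rho0 -> y0 sg = 0 -> 0 < eps ->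
  exists2 e, 0 < e & forall d rho y dy, 0 <= d -> d <= 1 -> d <= e ->
    emden p d rho y dy -> sg - eps < rho ->
    exists s, [/\ sg - eps < s < sg + eps, 0 < s <= rho & y s = 0].
Proof.
move=> /andP[sg0 sgr] ysg eps0.
pose B : R := rho0 + 1.
have r0 := emden_gt0 y0sol.
have B1 : 1 <= B by rewrite /B; lra.
have [c [c0 c1 cP]] := emden_nondegenerate p1 B1.
pose M := expR ((2 + p) * B) : R.
have M0 : 0 < M by exact: expR_gt0.
(* [t] is the half-width of the window: [eps / 4] keeps it near [sg], [sg / 4] keeps it positive,
   and [c / 12] is the transversality condition [3 * t <= (c / 2) / 2], with 3 the bound on the
   second derivative. *)
pose t : R := Num.min (eps / 4) (Num.min (c / 12) (sg / 4)).
have t0 : 0 < t by rewrite !lt_min !divr_gt0.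
have te : t <= eps / 4 by rewrite ge_min lexx.
have tc : t <= c / 12 by rewrite !ge_min lexx !orbT.
have ts : t <= sg / 4 by rewrite !ge_min lexx !orbT.
(* Both [|y0 (sg - tau)|] and the comparison error become at most [c * t / 8]; together they make
   [(c / 2) * t / 2], as transversality with slope [c / 2] requires. *)
pose tau : R := Num.min t (c * t / (8 * B)).
have tau0 : 0 < tau by rewrite lt_min t0 divr_gt0 ?mulr_gt0//; lra.
have taut : tau <= t by rewrite ge_min lexx.
have tauB : B * tau <= c * t / 8.
  have -> : c * t / 8 = B * (c * t / (8 * B)) by field; rewrite gt_eqF//; lra.
  by rewrite ler_wpM2l ?ge_min ?lexx ?orbT//; lra.
exists (c * t / (8 * M)); first by rewrite divr_gt0 ?mulr_gt0.
move=> d rho y dy d0 d1 de ysol sgrho.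
(* If the solution stops near [sg], its endpoint [rho] is the required zero. *)
have [rhoa|arho] := leP rho (sg - tau + t).
  exists rho; split; last exact: emden_yrho ysol.
    by rewrite sgrho/=; lra.
  by rewrite (emden_gt0 ysol) lexx.
have Md : M * d <= c * t / 8.
  have -> : c * t / 8 = M * (c * t / (8 * M)) by field; rewrite gt_eqF.
  by rewrite ler_wpM2l// ltW.
have a0 : 0 < sg - tau by lra.
have ar0 : 0 < sg - tau < rho0 by rewrite a0/=; lra.
have aB : sg - tau <= B by rewrite /B; lra.
have aI : 0 < sg - tau < Num.min rho rho0 by rewrite a0 lt_min; apply/andP; split; lra.
have [h1 h2] := emden_compare p1 d0 ysol y0sol aI aB.
have ct : c * t <= c by rewrite ler_piMr ?(ltW c0)//; lra.
have ct0 : 0 < c * t by rewrite mulr_gt0.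
have y0a : `|y0 (sg - tau)| <= c * t / 8.
  have sgt : sg - tau <= sg by lra.
  have sgB : sg <= B by rewrite /B; lra.
  have := emden_lipschitz p1 (lexx 0) y0sol (ltW a0) sgt sgr sgB.
  rewrite ysg sub0r normrN (_ : sg - (sg - tau) = tau); last by ring.
  by move=> h; exact: le_trans h tauB.
have dy0a : c <= `|dy0 (sg - tau)|.
  by apply: (cP 0 rho0 y0 dy0) => //; lra.
have [||||s sI ys] := @transversal_zero 0 rho (sg - tau) t (c / 2) 3 y dy _
    (emden_dy ysol) (emden_ddy ysol) (norm_ddy_le p1 d0 d1 ysol) _ arho t0.
- lra.
- lra.
- have := ler_normD (y (sg - tau) - y0 (sg - tau)) (y0 (sg - tau)).
  by move: h1; rewrite subrK -/M; lra.
- have := ler_normD (dy0 (sg - tau) - dy (sg - tau)) (dy (sg - tau)).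
  by move: h2; rewrite subrK distrC -/M; lra.
have /andP[s1 s2] := sI; exists s; split => //.
  by apply/andP; split; lra.
by apply/andP; split; lra.
Qed.

End Reference.
End ZeroConvergence.

(** * Convergence of the ordered list of zeros *)

Section ZeroLists.
Variable R : realType.
Implicit Types (p d rho a b s : R) (y dy : R -> R) (z : nat -> R).

Definition zeros_upto rho y (m : nat) z : Prop :=
  [/\ (forall i, (1 <= i < m)%N -> z i < z i.+1),
      z m = rho,
      (forall i, (1 <= i <= m)%N -> 0 < z i <= rho /\ y (z i) = 0) &
      (forall s, 0 < s <= rho -> y s = 0 -> exists2 i, (1 <= i <= m)%N & z i = s)].

Lemma zeros_upto_le rho y m z i j : zeros_upto rho y m z ->
  (1 <= i)%N -> (i <= j)%N -> (j <= m)%N -> z i <= z j.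
Proof.
move=> [zi _ _ _] i1; elim: j => [|j IH]; first by rewrite leqn0 => /eqP ->.
rewrite leq_eqVlt => /predU1P[-> //|]; rewrite ltnS => ij jm.
apply: le_trans (IH ij (ltnW jm)) _; apply/ltW/zi.
by rewrite jm (leq_trans i1 ij).
Qed.

(** The list is exhaustive, so no zero can hide between consecutive entries. The guard [1 <= i] lets
    [i = 0] speak of the first zero, [z 0] being unconstrained. *)
Lemma zeros_upto_next rho y m z i s : zeros_upto rho y m z ->
  (i < m)%N -> 0 < s <= rho -> y s = 0 -> ((1 <= i)%N -> z i < s) -> z i.+1 <= s.
Proof.
move=> zz im sr ys zs; have [_ _ _ /(_ s sr ys)[j /andP[j1 jm] zj]] := zz.
rewrite -zj (zeros_upto_le zz)// ltnNge; apply/negP => ji.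
have := zeros_upto_le zz j1 ji (ltnW im).
by rewrite zj leNgt zs// (leq_trans j1 ji).
Qed.

(** From below, [z k.+1] is separated from its predecessor by the uniform gap, and no zero survives
    where the reference solution has none. This also shows that [rho] reaches beyond
    [sg k.+1 - eps'], so a zero exists near [sg k.+1] and bounds [z k.+1] from above. *)
Lemma emden_zeros_cvg p rho0 y0 dy0 m (sg : nat -> R) :
  1 < p -> emden p 0 rho0 y0 dy0 -> zeros_upto rho0 y0 m sg ->
  forall k, (k <= m)%N -> forall eps : R, 0 < eps ->
  exists2 e, 0 < e & forall d rho y dy z, 0 <= d -> d <= 1 -> d <= e ->
    emden p d rho y dy -> zeros_upto rho y m z ->
    forall i, (1 <= i <= k)%N -> `|z i - sg i| < eps.
Proof.
move=> p1 y0sol sgz; have r0 := emden_gt0 y0sol.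
have [_ _ sgP _] := sgz.
pose B : R := rho0 + 1; have B1 : 1 <= B by rewrite /B; lra.
elim=> [_|k IH km] eps eps0.
  by exists 1 => // d rho y dy z _ _ _ _ _ [|i] /andP[].
have [sg0 ysg] := sgP k.+1 km; have /andP[sgp sgr] := sg0.
(* [a] separates the zeros of index at most [k] from the next one, and so do
   points closer to [sg k.+1] than [g]. *)
have [a [g [e1 [a0 g0 e10 sga hz]]]] : exists a g e1, [/\ 0 < a, 0 < g, 0 < e1,
   forall s, a <= s -> 0 < s <= rho0 -> y0 s = 0 -> sg k.+1 <= s &
   forall d rho y dy z, 0 <= d -> d <= 1 -> d <= e1 ->
    emden p d rho y dy -> zeros_upto rho y m z ->
    (z k.+1 <= B -> a <= z k.+1) /\
    (forall s, 0 < s <= rho -> y s = 0 -> sg k.+1 - g < s -> z k.+1 <= s)].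
  case: k IH km sg0 ysg sgp sgr => [|k] IH km sg0 ysg sgp sgr.
    (* No zero precedes the first one, and all zeros are at least 1, so any [a] below 1 will do and
       [g] is arbitrary. *)
    exists (1 / 2), 1, 1; split => //.
      by move=> s _ sr ys; apply: zeros_upto_next sgz _ sr ys _.
    move=> d rho y dy z d0 d1 _ ysol zz; have [_ _ zP _] := zz; split.
      by move=> _; have [zr yz] := zP 1%N km; have := emden_zero_ge1 p1 d0 ysol zr yz; lra.
    by move=> s sr ys _; apply: zeros_upto_next zz _ sr ys _.
  have [h h0 hP] := emden_zero_gap p1 B1.
  have sgk : sg k.+1 < sg k.+2 by have [+ _ _ _] := sgz; apply; rewrite km.
  have [/andP[sgk0 _] _] := sgP k.+1 (ltnW km).
  pose g := (sg k.+2 - sg k.+1) / 2; have gE : g * 2 = sg k.+2 - sg k.+1 by rewrite /g; field.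
  have g0 : 0 < g by lra.
  have m0 : 0 < Num.min (h / 2) g by rewrite lt_min g0 divr_gt0.
  have [e1 e10 e1P] := IH (ltnW km) _ m0.
  (* By induction [z k.+1] exceeds [sg k.+1 - h / 2], and the gap [h] pushes [z k.+2] beyond [a]. As
     [z k.+1] is also below [sg k.+1 + g], the midpoint of the two reference zeros, it precedes
     every zero beyond that midpoint. *)
  exists (sg k.+1 + h / 2), g, e1; split => //; first by lra.
    by move=> s as_ sr ys; apply: zeros_upto_next sgz km sr ys _ => _; lra.
  move=> d rho y dy z d0 d1 de ysol zz; have [zinc _ zP _] := zz.
  have := e1P d rho y dy z d0 d1 de ysol zz k.+1.
  rewrite ltr_norml lt_min ltrNl lt_min leqnn => /(_ isT) /andP[/andP[? ?] /andP[? ?]].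
  have [/andP[zk0 _] yzk] := zP k.+1 (ltnW km).
  have [/andP[_ zkr] yzk2] := zP k.+2 km.
  have zk2 : z k.+1 < z k.+2 by apply: zinc; rewrite km.
  split=> [zB|s sr ys gs].
    by have := hP _ _ _ _ d0 d1 ysol _ _ zk0 zk2 zkr zB yzk yzk2; lra.
  by apply: zeros_upto_next zz km sr ys _ => _; lra.
pose eps' := Num.min eps (Num.min g (sg k.+1 / 2)).
have eps'0 : 0 < eps' by rewrite !lt_min eps0 g0 divr_gt0.
have eps'e : eps' <= eps by rewrite ge_min lexx.
have eps'g : eps' <= g by rewrite !ge_min lexx orbT.
have eps's : eps' <= sg k.+1 / 2 by rewrite !ge_min lexx !orbT.
have [||e2 e20 e2P] := @emden_no_zero _ p rho0 y0 dy0 p1 y0sol a (sg k.+1 - eps') a0.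
- by lra.
- move=> s /andP[as_ ssg]; apply/negP => /eqP ys.
  by have := sga s as_ _ ys; move=> /(_ _)/wrap[]; [apply/andP; split; lra|lra].
have [e3 e30 e3P] := emden_zero_near p1 y0sol sg0 ysg eps'0.
have [e4 e40 e4P] := IH (ltnW km) _ eps0.
exists (Num.min e1 (Num.min e2 (Num.min e3 e4))); first by rewrite !lt_min e10 e20 e30.
move=> d rho y dy z d0 d1; rewrite !le_min => /and4P[de1 de2 de3 de4] ysol zz i /andP[i1].
rewrite leq_eqVlt => /predU1P[->{i i1}|ik]; last first.
  by apply: (e4P d rho y dy z) => //; rewrite i1.
have [za znext] := hz d rho y dy z d0 d1 de1 ysol zz.
have [_ _ zP _] := zz; have [/andP[zk0 zkr] yzk] := zP k.+1 km.
have lo : sg k.+1 - eps' < z k.+1.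
  (* Arguing by contradiction supplies the bound [z k.+1 <= B] that the gap estimate demands. *)
  rewrite ltNge; apply/negP => zlo.
  have zB : z k.+1 <= B by rewrite /B; lra.
  have := e2P d rho y dy d0 d1 de2 ysol (z k.+1) _ zkr.
  by rewrite yzk eqxx zlo (za zB) => /(_ isT).
have [s [/andP[s1 s2] sr ys]] := e3P d rho y dy d0 d1 de3 ysol (lt_le_trans lo zkr).
have := znext s sr ys; move=> /(_ _)/wrap[]; first lra.
by move=> h; rewrite ltr_norml; apply/andP; split; lra.
Qed.

End ZeroLists.

(** * Radial solutions as solutions of an ordinary differential equation *)

Section RadialReduction.
Variable R : realType.

(** The two difference quotients are the same function; this moves directional derivatives to
    one-variable calculus and back. *)
Lemma is_derive_lineP (V : normedModType R) (F : V -> R) (a v : V) (r l : R) :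
  is_derive (a + r *: v) v F l <-> is_derive r 1 (fun s => F (a + s *: v)) l.
Proof.
have E : (fun h : R => h^-1 *: ((F \o shift (a + r *: v)) (h *: v) - F (a + r *: v)))
  = (fun h : R => h^-1 *: (((fun s => F (a + s *: v)) \o shift r) (h *: 1)
      - F (a + r *: v))).
  by apply/funext => h /=; rewrite scalerDl [h *: 1]mulr1 addrCA.
split=> [] [D1 D2]; split.
- by move: D1; rewrite /derivable E.
- by move: D2; rewrite /derive E.
- by rewrite /derivable E.
- by rewrite /derive E.
Qed.

Section Axis.
Variable N : nat.
Implicit Types (i j : 'I_N) (r s : R).

Lemma enorm_axis i (s : R) : enorm (s *: evec R i) = `|s|.
Proof.
rewrite /enorm (bigD1 i)//= big1 => [|k ki]; last first.
  by rewrite !mxE eq_sym (negbTE ki) mulr0 expr0n.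
by rewrite !mxE eqxx mulr1 addr0 sqrtr_sqr.
Qed.

Lemma enorm_axis2 i j (r s : R) : i != j ->
  enorm (r *: evec R i + s *: evec R j) = Num.sqrt (r ^+ 2 + s ^+ 2).
Proof.
move=> ij; rewrite /enorm (bigD1 i)//= (bigD1 j) 1?eq_sym//= big1 => [|k /andP[ki kj]].
  by rewrite !mxE !eqxx (negbTE ij) eq_sym (negbTE ij) !mulr1 !mulr0 addr0 add0r addr0.
by rewrite !mxE eq_sym (negbTE ki) eq_sym (negbTE kj) !mulr0 addr0 expr0n.
Qed.

Lemma continuous_axis i : continuous (fun s : R => s *: evec R i).
Proof. by move=> s; apply: cvgZr_tmp; exact: cvg_id. Qed.

Section RadialODE.
Variables (f h : R -> R) (p : R) (i : 'I_N).
Hypothesis fsol : radial_dirichlet_sol (fun x : 'rV[R]_N => h (enorm x)) p f.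

Let U := radial N f.
Let df r : R := 'D_(evec R i) U (r *: evec R i).

Let ball_axis r : 0 <= r < 1 -> eball N 1 (r *: evec R i).
Proof. by move=> /andP[r0 r1]; rewrite /eball/= enorm_axis ger0_norm. Qed.

Let U_axis r : 0 <= r -> U (r *: evec R i) = f r.
Proof. by move=> r0; rewrite /U /radial enorm_axis ger0_norm. Qed.

(** [f] is unconstrained at negative radii, so it agrees with the restriction of [U] to the axis
    only near a positive [r]. *)
Lemma radial_is_derive r : 0 < r < 1 -> is_derive r 1 f (df r).
Proof.
move=> /andP[r0 r1]; have [C2 _ _ _] := fsol.
have [DU _ _] := C2 _ (ball_axis (introT andP (conj (ltW r0) r1))).
have : is_derive (0 + r *: evec R i) (evec R i) U (df r).
  by rewrite add0r /df; apply: derivableP; exact: diff_derivable.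
move=> /is_derive_lineP; apply: near_eq_is_derive; near=> s.
by rewrite add0r U_axis//; apply/ltW; near: s; exact: lt_nbhsr.
Unshelve. all: by end_near. Qed.

Let is_derive_df r : 0 < r < 1 ->
  is_derive r 1 df ('D_(evec R i) ('D_(evec R i) U) (r *: evec R i)).
Proof.
move=> /andP[r0 r1]; have [C2 _ _ _] := fsol.
have [_ DU _] := C2 _ (ball_axis (introT andP (conj (ltW r0) r1))).
have : is_derive (0 + r *: evec R i) (evec R i) ('D_(evec R i) U)
    ('D_(evec R i) ('D_(evec R i) U) (r *: evec R i)).
  by rewrite add0r; apply: derivableP; exact: diff_derivable.
move=> /is_derive_lineP; congr is_derive.
by apply/funext => s; rewrite add0r.
Qed.

(* On the line r e_i + s e_j the first derivative in direction j is explicit, so the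
   second one needs no second-order chain rule. *)
Let derive_transverse j r : i != j -> 0 < r < 1 ->
  'D_(evec R j) ('D_(evec R j) U) (r *: evec R i) = df r / r.
Proof.
move=> ij /andP[r0 r1].
pose q (s : R) : R := Num.sqrt (r ^+ 2 + s ^+ 2).
have rs s : 0 < r ^+ 2 + s ^+ 2 by rewrite ltr_pwDl ?sqr_ge0// exprn_gt0.
have q0 : q 0 = r by rewrite /q expr0n addr0 sqrtr_sqr gtr0_norm.
have Dq s : is_derive s 1 q (s / q s).
  have := is_derive1_sqrt (rs s) => D1.
  have D2 : is_derive s 1 (fun s : R => r ^+ 2 + s ^+ 2) (2 * s).
    by apply: is_derive_eq; rewrite /GRing.scale /=; ring.
  have D3 : is_derive s 1 q ((2 * q s)^-1 * (2 * s)).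
    exact: (@is_derive1_comp _ Num.sqrt (fun s => r ^+ 2 + s ^+ 2) s _ _ D1 D2).
  apply: (is_derive_eq D3).
  by field; rewrite gt_eqF// sqrtr_gt0.
have first s : q s < 1 ->
    'D_(evec R j) U (r *: evec R i + s *: evec R j) = df (q s) * (s / q s).
  move=> qs1; have qs0 : 0 < q s by rewrite sqrtr_gt0.
  apply: derive_val; apply/is_derive_lineP.
  have D1 : is_derive (q s) 1 f (df (q s)) by apply: radial_is_derive; rewrite qs0.
  have := is_derive1_comp D1 (Dq s); congr is_derive.
  by apply/funext => k; rewrite /U /radial enorm_axis2.
have D0 : is_derive (0 : R) 1 (fun s => df (q s) * (s / q s)) (df r / r).
  have D1 : is_derive (q 0) 1 df ('D_(evec R i) ('D_(evec R i) U) (q 0 *: evec R i)).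
    by apply: is_derive_df; rewrite q0 r0.
  have D2 := is_derive1_comp D1 (Dq 0).
  have qn0 : q 0 != 0 by rewrite q0 gt_eqF.
  have D3 := Dq 0; have D4 := is_deriveV qn0 D3.
  apply: is_derive_eq; rewrite /GRing.scale /= q0; ring.
have : is_derive (0 : R) 1 (fun s => 'D_(evec R j) U (r *: evec R i + s *: evec R j)) (df r / r).
  apply: near_eq_is_derive D0; near=> s; rewrite first//.
  near: s.
  have cq : q s @[s --> 0] --> q 0.
    apply/differentiable_continuous/derivable1_diffP.
    by have [] := Dq 0.
  by apply: (cvgr_lt _ cq); rewrite q0.
move=> /((is_derive_lineP ('D_(evec R j) U) (r *: evec R i) (evec R j) 0 _).2).
 by rewrite scale0r addr0 => -[].
Unshelve. all: by end_near. Qed.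

(** On the axis the Laplacian consists of one second derivative along it and [N - 1] equal
    transverse terms [df r / r]. *)
Lemma radial_is_derive2 r : 0 < r < 1 ->
  is_derive r 1 df (- ((N%:R - 1) / r * df r + h r * nlin p (f r))).
Proof.
move=> r01; have /andP[r0 r1] := r01; have := is_derive_df r01.
move=> D; apply: (is_derive_eq D).
have [_ _ /(_ _ (ball_axis (introT andP (conj (ltW r0) r1)))) + _] := fsol.
rewrite -/U U_axis ?ltW// enorm_axis gtr0_norm//.
rewrite /laplacian (bigD1 i)//= (eq_bigr (fun=> df r / r)); last first.
  by move=> j ji; rewrite derive_transverse// eq_sym.
rewrite sumr_const cardC1 card_ord -[_ *+ N.-1]mulr_natr.
have -> : N.-1%:R = N%:R - 1 :> R by rewrite -subn1 natrB// (leq_ltn_trans _ (ltn_ord i)).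
rewrite /nlin => h1.
lra.
Qed.

(** [df] is continuous at the origin by the regularity of [U], so the factor [r] kills the product
    whatever the value [df 0]. *)
Lemma radial_flux : r * df r @[r --> 0^'+] --> (0 : R).
Proof.
have [C2 _ _ _] := fsol.
have [_ DU _] := C2 _ (ball_axis (introT andP (conj (lexx 0) ltr01))).
have c : df r @[r --> 0] --> df 0.
  apply: (@continuous_comp _ _ _ (fun s : R => s *: evec R i) ('D_(evec R i) U)).
    exact: continuous_axis.
  exact: differentiable_continuous.
apply: cvg_at_right_filter; rewrite -[X in _ --> X](mul0r (df 0)).
by apply: cvgM; [exact: cvg_id | exact: c].
Qed.

Lemma radial_continuous : {within `[0, 1], continuous f}.
Proof.
have [_ cU _ _] := fsol; apply/subspace_continuousP => s /=.
rewrite in_itv/= => /andP[s0 s1].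
have sB : ecball N 1 (s *: evec R i) by rewrite /ecball/= enorm_axis ger0_norm.
have cUs := (subspace_continuousP _ _).1 cU _ sB.
have ax : s' *: evec R i @[s' --> within [set` `[0, 1]] (nbhs s)]
    --> within (ecball N 1) (nbhs (s *: evec R i)).
  move=> A /= /(continuous_axis (i := i)) hA.
  change (nbhs s [set x | [set` `[0, 1]] x -> A (x *: evec R i)]).
  change (nbhs s [set x | ecball N 1 (x *: evec R i) -> A (x *: evec R i)]) in hA.
  apply: filterS hA => x /= Ax; rewrite in_itv/= => /andP[x0 x1].
  by apply: Ax; rewrite /ecball/= enorm_axis ger0_norm.
have cUf : U (x *: evec R i) @[x --> within [set` `[0, 1]] (nbhs s)] --> f s.
  by rewrite -(U_axis s0); exact: (cvg_comp _ _ ax cUs).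
apply: cvg_trans cUf; apply: near_eq_cvg.
change (nbhs s [set x | [set` `[0, 1]] x -> U (x *: evec R i) = f x]).
by apply: filterE => x /=; rewrite in_itv/= => /andP[x0 _]; rewrite U_axis.
Qed.

Lemma radial_boundary : f 1 = 0.
Proof.
have [_ _ _ /(_ (1 *: evec R i))] := fsol.
by rewrite enorm_axis normr1 -/U U_axis ?ler01// => /(_ erefl).
Qed.

End RadialODE.
End Axis.
End RadialReduction.

(** * Change of variables *)

Section ChangeOfVariables.
Variable R : realType.

Lemma cvg_to_at_right (T : Type) (F : set_system T) {FF : Filter F} (g : T -> R) a :
  g @ F --> a -> (\forall x \near F, a < g x) -> g @ F --> a^'+.
Proof.
move=> ga gp P /= hP; have := ga _ hP; rewrite /fmap/= => h.
by apply: filterS2 gp h => x agx; exact.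
Qed.

Lemma cvg_to_at_left (T : Type) (F : set_system T) {FF : Filter F} (g : T -> R) a :
  g @ F --> a -> (\forall x \near F, g x < a) -> g @ F --> a^'-.
Proof.
move=> ga gp P /= hP; have := ga _ hP; rewrite /fmap/= => h.
by apply: filterS2 gp h => x agx; exact.
Qed.

Lemma powR_lt1 (x k : R) : 0 < x < 1 -> 0 < k -> 0 < x `^ k < 1.
Proof.
move=> /andP[x0 x1] k0; rewrite powR_gt0//=.
have := @gt0_ltr_powR R k k0 x 1; rewrite powR1; apply => //.
  by rewrite nnegrE ltW.
by rewrite nnegrE.
Qed.

Lemma powR_le1 (x k : R) : 0 <= x <= 1 -> 0 <= k -> x `^ k <= 1.
Proof.
move=> /andP[x0 x1] k0; rewrite [leRHS](_ : 1 = 1 `^ k); last by rewrite powR1.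
by apply: ge0_ler_powR; rewrite ?nnegrE.
Qed.

Lemma powRVK (x k : R) : 0 <= x -> k != 0 -> (x `^ k) `^ k^-1 = x.
Proof. by move=> x0 k0; rewrite -powRrM divff// powRr1. Qed.

Lemma powRKV (x k : R) : 0 <= x -> k != 0 -> (x `^ k^-1) `^ k = x.
Proof. by move=> x0 k0; rewrite -powRrM mulVf// powRr1. Qed.

Section Profile.
Variables (N : nat) (p al : R) (f : R -> R).
Implicit Types s : R.
Let k : R := 2 / (al + 2).
Let A : R := f 0.

(** The scale for which the nonlinearity gets coefficient 1: with [k = 2 / (al + 2)], its square is
    [k ^ 2 * f 0 ^ (p - 1)]. *)
Definition profile_radius : R := 2 / (al + 2) * f 0 `^ ((p - 1) / 2).
Definition profile (s : R) : R :=
  f ((s / profile_radius) `^ (2 / (al + 2))) / f 0.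

Let rho := profile_radius.
Let y := profile.
Let r s : R := (s / rho) `^ k.

Hypotheses (N2 : (2 <= N)%N) (p1 : 1 < p) (al0 : 0 <= al) (f0 : 0 < f 0).
Hypothesis fsol :
  radial_dirichlet_sol (fun x : 'rV[R]_N => powR (enorm x) al) p f.

Let k0 : 0 < k. Proof. by rewrite divr_gt0//; have := al0 => ?; lra. Qed.
Let rho_gt0 : 0 < rho. Proof. by rewrite mulr_gt0 ?powR_gt0. Qed.

Let rho_sq : rho ^+ 2 = k ^+ 2 * A `^ (p - 1).
Proof.
rewrite /rho /profile_radius exprMn -[(f 0 `^ _) ^+ 2]powR_mulrn ?powR_ge0// -powRrM.
by rewrite divfK.
Qed.

Let r_itv s : 0 < s < rho -> 0 < r s < 1.
Proof.
move=> /andP[s0 sr]; apply: powR_lt1 => //.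
by rewrite divr_gt0//= ltr_pdivrMr// mul1r.
Qed.

(** The choice of [k] amounts to [k * (2 + al) = 2], which absorbs the weight. *)
Let r_weight s : 0 < s -> r s ^+ 2 * r s `^ al = (s / rho) ^+ 2.
Proof.
move=> s0; have r0 : 0 < r s by rewrite powR_gt0// divr_gt0.
rewrite -(powR_mulrn 2) ?(ltW r0)// -powRD; last by rewrite (gt_eqF r0) implybT.
rewrite /r -powRrM (_ : k * (2 + al) = 2); last first.
  by rewrite /k; field; rewrite gt_eqF//; have := al0 => ?; lra.
by rewrite powR_mulrn// divr_ge0// ltW.
Qed.

Let is_derive_r s : 0 < s -> is_derive s 1 r (k * r s / s).
Proof.
move=> s0; have sr : 0 < s / rho by rewrite divr_gt0.
have D1 := is_derive1_powR k sr.
have D2 : is_derive s 1 (fun s => s / rho) rho^-1.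
  by apply: is_derive_eq; rewrite /GRing.scale /=; ring.
have D3 : is_derive s 1 r (k * (s / rho) `^ (k - 1) * rho^-1).
  exact: (@is_derive1_comp _ (@powR R ^~ k) (fun s => s / rho) s _ _ D1 D2).
apply: (is_derive_eq D3); rewrite powRB ?(gt_eqF sr) ?implybT// powRr1 ?ltW//.
by rewrite -/(r s); field; rewrite !gt_eqF.
Qed.

Let r_cvg0 : r s @[s --> 0^'+] --> 0^'+.
Proof.
apply: cvg_to_at_right; last first.
  by near=> s; apply: powR_gt0; rewrite divr_gt0.
apply: (@cvg_comp _ _ _ (fun s => s / rho) (@powR R ^~ k) _ (0^'+)); last exact: powR_cvg0.
apply: cvg_to_at_right; last by near=> s; rewrite divr_gt0.
apply: cvg_at_right_filter; rewrite -[X in _ --> X](mul0r rho^-1).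
exact: mulrr_continuous.
Unshelve. all: by end_near. Qed.

Let r_cvg1 : r s @[s --> rho^'-] --> 1^'-.
Proof.
apply: cvg_to_at_left; last first.
  near=> s.
  have : 0 < s < rho.
    by apply/andP; split => //; near: s; exact: nbhs_left_gt.
  by move=> /r_itv /andP[].
apply: cvg_at_left_filter.
have -> : 1 = r rho by rewrite /r divff ?gt_eqF// powR1.
apply/differentiable_continuous/derivable1_diffP.
by have [] := is_derive_r rho_gt0.
Unshelve. all: by end_near. Qed.

Lemma profile_radius_gt0 : 0 < profile_radius. Proof. exact: rho_gt0. Qed.

(** Since [s d/ds = k r d/dr], the form [(r d/dr)^2 + (N - 2) (r d/dr)] of [r^2] times the radial
    Laplacian shows where [d = k (N - 2)] comes from. Assuming only [2 <= N] lets the lemma cover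
    [w] as well. *)
Lemma profile_emden : exists dy, emden p (2 / (al + 2) * (N%:R - 2)) rho y dy.
Proof.
have i : 'I_N by exact: (Ordinal (ltnW N2)).
pose df (r : R) : R := 'D_(evec R i) (radial N f) (r *: evec R i).
pose h (x : R) := x `^ al.
have fsol' : radial_dirichlet_sol (fun x : 'rV[R]_N => h (enorm x)) p f := fsol.
have [D1 D2] := (radial_is_derive i fsol', radial_is_derive2 i fsol').
have fx := radial_flux i fsol'; have fc := radial_continuous i fsol'.
have f1 := radial_boundary i fsol'.
have [fd fr fl] := (continuous_within_itvP f ltr01).1 fc.
have A0 : A != 0 by rewrite gt_eqF.
have rn0 : rho != 0 by rewrite gt_eqF.
have r00 : r 0 = 0 by rewrite /r mul0r powR0// gt_eqF.
have r1 : r rho = 1 by rewrite /r divff// powR1.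
have Dy s : 0 < s < rho -> is_derive s 1 y (k / A * (r s * df (r s)) / s).
  move=> sr; have /andP[s0 _] := sr.
  have D3 : is_derive (r s) 1 f (df (r s)) := D1 _ (r_itv sr).
  have D4 := is_derive_r s0.
  have D5 := @is_derive1_comp _ f r s _ _ D3 D4.
  have D6 : is_derive s 1 (fun s => (f \o r) s / A) (df (r s) * (k * r s / s) / A).
    by apply: is_derive_eq; rewrite /GRing.scale /=; ring.
  apply: (is_derive_eq D6); ring.
(* In this form [s * dy s] is a constant times the radial flux composed with [r]. *)
exists (fun s => k / A * (r s * df (r s)) / s); split; first exact: rho_gt0.
- by rewrite /y /profile -/rho -/(r 0) r00 divff.
- by rewrite /y /profile -/(r rho) r1 f1 mul0r.
- apply/continuous_within_itvP => //; split.
  + move=> s; rewrite in_itv/= => /Dy[+ _] => /derivable1_diffP.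
    exact: differentiable_continuous.
  + rewrite /y /profile -/(r 0) r00; apply: cvgMl.
    exact: (cvg_comp _ _ r_cvg0 fr).
  + rewrite /y /profile -/(r rho) r1; apply: cvgMl.
    exact: (cvg_comp _ _ r_cvg1 fl).
- exact: Dy.
- move=> s sr; have /andP[s0 _] := sr; have /andP[r0 _] := r_itv sr.
  have D3 : is_derive (r s) 1 f (df (r s)) := D1 _ (r_itv sr).
  have D4 := is_derive_r s0.
  have D5 : is_derive (r s) 1 df
      (- ((N%:R - 1) / r s * df (r s) + h (r s) * nlin p (f (r s)))) := D2 _ (r_itv sr).
  have D6 := @is_derive1_comp _ df r s _ _ D5 D4.
  have sn0 : s != 0 by rewrite gt_eqF.
  have D7 := is_deriveV sn0 (is_derive_id s 1).
  suff : is_derive s 1 (fun s => k / A * (r s * (df \o r) s) / s)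
    (- ((1 + 2 / (al + 2) * (N%:R - 2)) / s * (k / A * (r s * df (r s)) / s)
        + nlin p (y s))) by [].
  apply: is_derive_eq.
  have e1 : nlin p (y s) = nlin p (f (r s)) / A `^ p.
    rewrite (_ : f (r s) = A * y s); last by rewrite /y /profile mulrCA divff// mulr1.
    rewrite nlinM ?ltW// mulrC mulKf//.
    by rewrite gt_eqF// powR_gt0.
  rewrite e1 -(mulr_powRB1 (ltW f0) (lt_trans ltr01 p1)) -/A.
  have a0 : 0 < A `^ (p - 1) by rewrite powR_gt0.
  have hE : h (r s) = s ^+ 2 / (k ^+ 2 * A `^ (p - 1) * r s ^+ 2).
    rewrite -rho_sq; apply: (mulfI (_ : r s ^+ 2 != 0)); first by rewrite expf_neq0// gt_eqF.
    by rewrite r_weight//; field; rewrite rn0 gt_eqF.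
  rewrite hE -/k /GRing.scale /=.
  by field; rewrite A0 sn0 !gt_eqF.
- have lim0 : k / A * (r s * df (r s)) @[s --> 0^'+] --> (0 : R).
    rewrite -[X in _ --> X](mulr0 (k / A)); apply: cvgMr.
    exact: (cvg_comp _ _ r_cvg0 fx).
  apply: cvg_trans lim0; apply: near_eq_cvg; near=> s.
  by field; rewrite A0 gt_eqF.
Unshelve. all: by end_near. Qed.

Lemma profile_zeros m z : zeros_of f m z ->
  zeros_upto rho y m (fun i => rho * z i `^ k^-1).
Proof.
move=> [zi zm zP zE]; have kn0 : k != 0 by rewrite gt_eqF.
have rK s : 0 <= s -> r (rho * s `^ k^-1) = s.
  by move=> s0; rewrite /r mulrC mulKf ?gt_eqF// powRKV.
split=> [i /andP[i1 im]| |i iI|s /andP[s0 sr] ys].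
- have [/andP[zi0 _] _] : 0 < z i <= 1 /\ f (z i) = 0 by apply: zP; rewrite i1 ltnW.
  have zz := zi i; rewrite i1 im in zz; have {zz} zz := zz isT.
  rewrite ltr_pM2l// gt0_ltr_powR ?invr_gt0// nnegrE ltW//.
  exact: lt_trans zz.
- by rewrite zm powR1 mulr1.
- have [/andP[zi0 zi1] fz] := zP i iI; split.
    rewrite mulr_gt0 ?powR_gt0//= ler_piMr ?(ltW rho_gt0)//.
    by rewrite powR_le1 ?invr_ge0 ?(ltW k0)// (ltW zi0).
  by rewrite /y /profile -/(r (rho * _)) rK ?fz ?mul0r// ltW.
- have rs0 : 0 < r s by rewrite powR_gt0// divr_gt0.
  have rs1 : r s <= 1.
    apply: powR_le1; last exact: ltW.
    by rewrite divr_ge0 ?(ltW s0) ?(ltW rho_gt0)//= ler_pdivrMr// mul1r.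
  have fr : f (r s) = 0.
    by move/eqP: ys; rewrite mulf_eq0 invr_eq0 (gt_eqF f0) orbF => /eqP.
  have [i iI ziE] := zE (r s) (introT andP (conj rs0 rs1)) fr.
  exists i; first exact: iI.
  rewrite ziE /r powRVK ?divr_ge0 ?(ltW s0) ?(ltW rho_gt0)//.
  by rewrite mulrC divfK// gt_eqF.
Qed.

End Profile.
End ChangeOfVariables.

(** * Asymptotics *)

Lemma profileK (R : realType) (p al : R) (f : R -> R) (x : R) :
  0 <= al -> 0 < f 0 -> 0 <= x ->
  f x = f 0 * profile p al f (profile_radius p al f * x `^ (2 / (al + 2))^-1).
Proof.
move=> al0 f0 x0; rewrite /profile [profile_radius _ _ _ * _]mulrC mulfK; last first.
  by rewrite gt_eqF// profile_radius_gt0.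
rewrite powRKV//; first by rewrite mulrCA divff ?mulr1// gt_eqF.
by rewrite gt_eqF// divr_gt0//; lra.
Qed.

Lemma norm_emden_le1_closed (R : realType) (p d rho : R) (y dy : R -> R) (s : R) :
  1 < p -> 0 <= d -> emden p d rho y dy -> 0 <= s <= rho -> `|y s| <= 1.
Proof.
move=> p1 d0 ysol /andP[]; rewrite le_eqVlt => /predU1P[<- _|s0].
  by rewrite (emden_y0 ysol) normr1.
rewrite le_eqVlt => /predU1P[->|sr]; first by rewrite (emden_yrho ysol) normr0.
by apply: (norm_emden_le1 p1 d0 ysol); rewrite s0.
Qed.

Section Asymptotics.
Variables (R : realType) (N : nat) (p : R) (m : nat).
Variables (u : R -> R -> R) (w : R -> R) (r : R -> nat -> R) (t : nat -> R).
Hypotheses (N2 : (2 <= N)%N) (p1 : 1 < p) (m0 : (0 < m)%N).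
Hypothesis usol : forall al, alpha_p N p < al ->
  radial_dirichlet_sol (fun x : 'rV[R]_N => powR (enorm x) al) p (u al) /\ 0 < u al 0.
Hypothesis wsol : radial_dirichlet_sol (fun _ : 'rV[R]_2 => 1) p w /\ 0 < w 0.
Hypothesis uz : forall al, alpha_p N p < al -> zeros_of (u al) m (r al).
Hypothesis wz : zeros_of w m t.

Let k (al : R) : R := 2 / (al + 2).
Let rho al := profile_radius p al (u al).
Let y al := profile p al (u al).
Let zeta al i := rho al * r al i `^ (k al)^-1.
Let rho0 := profile_radius p 0 w.

Lemma alpha_p_ge0 : 0 <= alpha_p N p.
Proof. by rewrite /alpha_p le_max lexx. Qed.

Let k0E : 2 / (0 + 2) = 1 :> R. Proof. by field. Qed.

Let w_emden : exists dy0, emden p 0 rho0 (profile p 0 w) dy0.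
Proof.
have [wr w0] := wsol.
have wr' : radial_dirichlet_sol (fun x : 'rV[R]_2 => powR (enorm x) 0) p w.
  by move: wr; congr radial_dirichlet_sol; apply/funext => x; rewrite powRr0.
have [dy0] := profile_emden (leqnn 2) p1 (lexx 0) w0 wr'.
by rewrite subrr mulr0; exists dy0.
Qed.

Let w_zeros : zeros_upto rho0 (profile p 0 w) m (fun i => rho0 * t i).
Proof.
have [wr w0] := wsol; have := profile_zeros p (lexx 0) w0 wz.
move=> [h1 h2 h3 h4]; have [_ t1 tP _] := wz.
have e i : (1 <= i <= m)%N -> rho0 * t i `^ (2 / (0 + 2))^-1 = rho0 * t i.
  by move=> /tP[/andP[ti _] _]; rewrite k0E invr1 powRr1// ltW.
split.
- by move=> i /andP[i1 im]; have := h1 i; rewrite i1 im => /(_ isT); rewrite -!e ?i1// ltnW.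
- by rewrite t1 mulr1.
- by move=> i iI; have := h3 i iI; rewrite -/rho0 e.
- by move=> s sr ys; have [i iI <-] := h4 s sr ys; exists i => //; rewrite -/rho0 e.
Qed.

Lemma profile_asymptotics eps : 0 < eps ->
  exists2 a1, alpha_p N p < a1 & forall al, a1 <= al -> exists d dy,
    [/\ 0 <= d, d <= 1, emden p d (rho al) (y al) dy,
        zeros_upto (rho al) (y al) m (zeta al) &
        forall i, (1 <= i <= m)%N -> `|zeta al i - rho0 * t i| < eps].
Proof.
move=> eps0; have [dy0 y0sol] := w_emden.
have [e e0 eP] := emden_zeros_cvg p1 y0sol w_zeros (leqnn m) eps0.
(* For [al >= b] the parameter [2 (N - 2) / (al + 2)] is at most [min e 1]. *)
pose b : R := 2 * N%:R / Num.min e 1.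
have b0 : 0 <= b by rewrite divr_ge0 ?mulr_ge0// le_min ler01 ltW.
have N2' : 2 <= N%:R :> R by rewrite ler_nat.
exists (alpha_p N p + b + 1); first lra.
move=> al ala; have al_p : alpha_p N p < al by lra.
have alp0 := alpha_p_ge0.
have al0 : 0 <= al by lra.
have [ur u0] := usol al_p.
have [dy ysol] := profile_emden N2 p1 al0 u0 ur.
exists (k al * (N%:R - 2)), dy.
have d0 : 0 <= k al * (N%:R - 2) by rewrite mulr_ge0// ?subr_ge0// divr_ge0//; lra.
have /andP[de d1] : (k al * (N%:R - 2) <= e) && (k al * (N%:R - 2) <= 1).
  rewrite -le_min /k mulrAC ler_pdivrMr; last lra.
  apply: (@le_trans _ _ (Num.min e 1 * b)).
    rewrite [leRHS]mulrC divfK; last by rewrite gt_eqF// lt_min e0 ltr01.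
    by lra.
  by rewrite ler_wpM2l ?le_min ?ler01 ?(ltW e0)//; lra.
have zz := profile_zeros p al0 u0 (uz al_p).
by split => //; apply: (eP _ _ _ _ _ d0 d1 de ysol zz).
Qed.

Let zeta_cvg i : (1 <= i <= m)%N -> zeta al i @[al --> +oo] --> rho0 * t i.
Proof.
move=> iI; apply/cvgrPdist_lt => e e0.
have [a1 _ aP] := profile_asymptotics e0.
near=> al; rewrite distrC.
have ala : a1 <= al by near: al; apply: nbhs_pinfty_ge; exact: num_real.
by have [d [dy [_ _ _ _ h]]] := aP al ala; exact: h.
Unshelve. all: by end_near. Qed.

Let rho_cvg : rho al @[al --> +oo] --> rho0.
Proof.
have [_ t1 _ _] := wz.
have := @zeta_cvg m; rewrite m0 leqnn t1 mulr1 => /(_ isT).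
apply: cvg_trans; apply: near_eq_cvg; near=> al.
have alp : alpha_p N p < al by near: al; apply: nbhs_pinfty_gt; exact: num_real.
have [_ z1 _ _] := uz alp.
by rewrite /zeta z1 powR1 mulr1.
Unshelve. all: by end_near. Qed.

Let rho0_gt0 : 0 < rho0.
Proof. by have [_ w0] := wsol; exact: profile_radius_gt0. Qed.

Let k_cvg : k al @[al --> +oo] --> 0.
Proof.
apply/cvgrPdist_lt => e e0; near=> al.
have al0 : 0 < al by near: al; apply: nbhs_pinfty_gt; exact: num_real.
have k0 : 0 < k al by rewrite divr_gt0//; lra.
rewrite sub0r normrN gtr0_norm// /k ltr_pdivrMr; last lra.
rewrite mulrC -ltr_pdivrMr//.
have : 2 / e < al by near: al; apply: nbhs_pinfty_gt; exact: num_real.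
lra.
Unshelve. all: by end_near. Qed.

Lemma zeros_asymptotics i : (1 <= i <= m)%N ->
  (fun al => al * (1 - r al i)) @ +oo --> - 2 * ln (t i).
Proof.
move=> iI; have [_ _ tP _] := wz; have [/andP[ti0 ti1] _] := tP i iI.
pose x al := zeta al i / rho al.
have xt : x al @[al --> +oo] --> t i.
  have -> : t i = rho0 * t i * rho0^-1 by rewrite mulrAC divff ?mul1r// gt_eqF.
  by apply: cvgM; [exact: zeta_cvg|apply: cvgV => //; rewrite gt_eqF].
pose v al := k al * ln (x al).
have lx : ln (x al) @[al --> +oo] --> ln (t i).
  exact: (cvg_comp _ _ xt (continuous_ln ti0)).
have v0 : v al @[al --> +oo] --> 0.
  by rewrite -[X in _ --> X](mul0r (ln (t i))); exact: cvgM.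
(* As [al * k al = 2 * (1 - k al)], this is [- al * v al], where [r al i = expR (v al)]. The
   inequalities [1 + v <= expR v <= 1 / (1 - v)] squeeze [al * (1 - r al i)] between
   [lo al / (1 - v al)] and [lo al]. *)
pose lo al := - (2 * (1 - k al) * ln (x al)).
have loc : lo al @[al --> +oo] --> - 2 * ln (t i).
  rewrite [X in _ --> X](_ : _ = - (2 * (1 - 0) * ln (t i))); last by ring.
  apply: cvgN; apply: cvgM => //; apply: cvgM; first exact: cvg_cst.
  by apply: cvgB => //; exact: cvg_cst.
have hic : lo al / (1 - v al) @[al --> +oo] --> - 2 * ln (t i).
  rewrite [X in _ --> X](_ : _ = - 2 * ln (t i) / (1 - 0)); last by rewrite subr0 divr1.
  apply: cvgM => //; apply: cvgV; first by rewrite subr0.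
  by apply: cvgB => //; exact: cvg_cst.
apply: (squeeze_cvgr _ hic loc).
near=> al.
have alp : alpha_p N p < al by near: al; apply: nbhs_pinfty_gt; exact: num_real.
have al0 : 0 < al by exact: le_lt_trans alpha_p_ge0 alp.
have [_ _ zP _] := uz alp; have [/andP[ri0 ri1] _] := zP i iI.
have k0 : 0 < k al by rewrite divr_gt0//; lra.
have [_ u0] := usol alp.
have rho_n0 : rho al != 0 by rewrite gt_eqF// profile_radius_gt0// ltW.
have xE : x al = r al i `^ (k al)^-1.
  by rewrite /x /zeta mulrAC divff// mul1r.
have x1 : 0 < x al <= 1.
  by rewrite xE powR_gt0//= powR_le1 ?(ltW ri0)// invr_ge0 ltW.
have rE : r al i = expR (v al).
  rewrite /v -ln_powR lnK.
    by rewrite xE powRKV ?(ltW ri0)// gt_eqF.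
  by rewrite posrE powR_gt0//; case/andP: x1.
have v_le0 : v al <= 0.
  by rewrite /v mulr_ge0_le0 ?(ltW k0)// ln_le0//; case/andP: x1.
have loE : lo al = al * - v al.
  by rewrite /lo /v /k; field; rewrite gt_eqF//; lra.
rewrite rE loE -mulrA; apply/andP; split; rewrite ler_wpM2l ?(ltW al0)//.
  have h := expR_ge1Dx (- v al); have v1 : 0 < 1 - v al by lra.
  suff : expR (v al) <= (1 - v al)^-1.
    have -> : - v al / (1 - v al) = 1 - (1 - v al)^-1 by field; rewrite gt_eqF.
    lra.
  by rewrite -[v al in leLHS]opprK expRN lef_pV2 ?posrE ?expR_gt0.
by have := expR_ge1Dx (v al); lra.
Unshelve. all: by end_near. Qed.

Let q : R := 2 / (p - 1).

Let q0 : 0 < q. Proof. by rewrite divr_gt0//; have := p1 => ?; lra. Qed.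

(** Converts the endpoint into the amplitude: [q] is the inverse of the exponent [(p - 1) / 2]. *)
Let radius_powR (al : R) (f : R -> R) : 0 <= al -> 0 < f 0 ->
  profile_radius p al f `^ q = k al `^ q * f 0.
Proof.
move=> al0 f0; have k0 : 0 <= k al by rewrite divr_ge0//; lra.
rewrite /profile_radius powRM ?powR_ge0// -powRrM.
have -> : (p - 1) / 2 * q = 1.
  by rewrite /q; field; rewrite gt_eqF//; have := p1 => ?; lra.
by rewrite powRr1 ?ltW.
Qed.

Let rho0q : rho0 `^ q = w 0.
Proof.
have [_ w0] := wsol.
by rewrite radius_powR// /k k0E powR1 mul1r.
Qed.

(** The scaled solution is [rho al ^ q * y al s] with [s = rho al * |x| ^ (1 / k al)]. For
    [|x| < R0] this [s] tends to 0 uniformly, and [|y al s - 1| <= s ^ 2]; [b al] collects the two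
    errors. *)
Lemma center_asymptotics (R0 : R) : 0 < R0 < 1 ->
  forall eps : R, 0 < eps -> exists A : R, forall al, A <= al ->
    alpha_p N p < al -> forall x : 'rV[R]_N, enorm x < R0 ->
    `| powR (2 / (al + 2)) q * u al (enorm x) - w 0 | < eps.
Proof.
move=> R01 eps eps0; have /andP[R00 R0lt1] := R01.
have L0 : 0 < - ln R0 by rewrite oppr_gt0 ln_lt0.
pose b al := `|rho al `^ q - rho0 `^ q| + rho al `^ q * (rho al * (k al / - ln R0)) ^+ 2.
have rq : rho al `^ q @[al --> +oo] --> rho0 `^ q.
  have cq : {for rho0, continuous (fun x : R => x `^ q)}.
    apply/differentiable_continuous/derivable1_diffP.
    by have [] := is_derive1_powR q rho0_gt0.
  exact: (cvg_comp _ _ rho_cvg cq).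
have b0 : b al @[al --> +oo] --> 0.
  rewrite -[X in _ --> X]addr0; apply: cvgD.
    have c0 : rho al `^ q - rho0 `^ q @[al --> +oo] --> (0 : R).
      by rewrite -[X in _ --> X](subrr (rho0 `^ q)); exact: cvgB rq (cvg_cst _).
    by rewrite -[X in _ --> X](normr0 R); exact: cvg_norm c0.
  have c : rho al * (k al / - ln R0) @[al --> +oo] --> 0.
    rewrite -[X in _ --> X](mulr0 rho0); apply: (cvgM rho_cvg).
    by rewrite -[X in _ --> X](mul0r (- ln R0)^-1); exact: cvgM k_cvg (cvg_cst _).
  rewrite -[X in _ --> X](mulr0 (rho0 `^ q)); apply: (cvgM rq).
  by rewrite -[X in _ --> X](mulr0 0); exact: (cvgM c c).
have [M [_ MP]] := cvgr0_norm_lt _ b0 _ eps0.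
have [a1 _ aP] := profile_asymptotics ltr01.
exists (Num.max (M + 1) a1) => al; rewrite ge_max => /andP[alM ala1] alp x xR.
have al0 : 0 < al by exact: le_lt_trans alpha_p_ge0 alp.
have k0 : 0 < k al by rewrite divr_gt0//; lra.
have [_ u0] := usol alp.
have rho_gt0 : 0 < rho al by apply: profile_radius_gt0 => //; exact: ltW.
have [d [dy [d0 d1 ysol _ _]]] := aP al ala1.
have x0 : 0 <= enorm x by exact: sqrtr_ge0.
rewrite (profileK p (ltW al0) u0 x0) mulrA -/(k al) -radius_powR ?(ltW al0)//.
rewrite -/(rho al) -/(y al) -rho0q.
set s := rho al * enorm x `^ _.
(* [expR z >= z] with [z = - ln R0 / k al] replaces exponential decay by a linear bound in [k al],
   which is enough. *)
have R0k : R0 `^ (k al)^-1 <= k al / - ln R0.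
  have L1 : 0 < - ln R0 / k al by exact: divr_gt0.
  have -> : R0 `^ (k al)^-1 = (expR (- ln R0 / k al))^-1.
    by rewrite -expRN /powR gt_eqF//; congr expR; ring.
  rewrite -[k al / _]invf_div lef_pV2 ?posrE ?expR_gt0//.
  by apply: le_trans (expR_ge1Dx _); lra.
have ss : s <= rho al * (k al / - ln R0).
  rewrite ler_wpM2l ?(ltW rho_gt0)//; apply: le_trans R0k.
  by apply: ge0_ler_powR; rewrite ?nnegrE ?invr_ge0 ?(ltW k0) ?(ltW R00) ?(ltW xR).
have s0 : 0 <= s by rewrite mulr_ge0 ?powR_ge0// ltW.
have sr : s <= rho al.
  rewrite ler_piMr ?(ltW rho_gt0)// powR_le1 ?x0 ?invr_ge0 ?(ltW k0)//.
  by rewrite ltW// (lt_trans xR).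
have ys : `|y al s - 1| <= (rho al * (k al / - ln R0)) ^+ 2.
  have := emden_lipschitz p1 d0 ysol (lexx 0) s0 sr (lexx s).
  rewrite (emden_y0 ysol) subr0 -expr2 => h; apply: le_trans h _.
  by rewrite lerXn2r// nnegrE// (le_trans s0 ss).
have bb : b al < eps.
  by apply: le_lt_trans (ler_norm _) _; apply: MP; lra.
apply: le_lt_trans bb.
have e (a b1 z : R) : a * z - b1 = (a - b1) + a * (z - 1) by ring.
rewrite e; apply: le_trans (ler_normD _ _) _; rewrite lerD2l normrM.
by rewrite ger0_norm ?powR_ge0// ler_wpM2l// powR_ge0.
Qed.

(** [u al 0] is [rho al ^ q] times the scale, and [1 <= rho al <= rho0 + 1]. All maxima are at most
    [u al 0] because [|y| <= 1]; the first one equals it, and the later ones are at least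
    [c * u al 0] by the uniform bump height. *)
Lemma Mmax_bounds : exists alpha0 : R, exists C1 : R, exists C2 : R,
  [/\ alpha_p N p < alpha0, 0 < C1, 0 < C2 &
    forall i al, (1 <= i <= m)%N -> alpha0 <= al ->
      C1 * powR ((al + 2) / 2) q <= Mmax (u al) (r al) i
      /\ Mmax (u al) (r al) i <= C2 * powR ((al + 2) / 2) q].
Proof.
have B1 : 1 <= rho0 + 1 by have := rho0_gt0; lra.
have [c [c0 c1 cP]] := emden_bump p1 B1.
have [a1 a1p aP] := profile_asymptotics ltr01.
exists a1, c, ((rho0 + 1) `^ q); split => //.
  by rewrite powR_gt0//; lra.
move=> i al iI ala1; have alp := lt_le_trans a1p ala1.
have al0 : 0 < al by exact: le_lt_trans alpha_p_ge0 alp.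
have k0 : 0 < k al by rewrite divr_gt0//; lra.
have [_ u0] := usol alp.
have rho_gt0 : 0 < rho al by apply: profile_radius_gt0 => //; exact: ltW.
have [d [dy [d0 d1 ysol zz zt]]] := aP al ala1.
have [rinc rm rP _] := uz alp; have [_ zm zP _] := zz.
have rhoB : rho al <= rho0 + 1.
  have [_ t1 _ _] := wz.
  have := zt m; rewrite m0 leqnn t1 mulr1 zm ltr_norml => /(_ isT) /andP[_]; lra.
have uE : u al 0 = rho al `^ q * ((al + 2) / 2) `^ q.
  rewrite radius_powR ?(ltW al0)// mulrAC -powRM ?divr_ge0//; try lra.
  rewrite /k (_ : 2 / (al + 2) * ((al + 2) / 2) = 1) ?powR1 ?mul1r//.
  by field; rewrite gt_eqF//; lra.
set T := ((al + 2) / 2) `^ q in uE *.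
have T0 : 0 <= T by exact: powR_ge0.
have rq1 : 1 <= rho al `^ q.
  have -> : 1 = 1 `^ q :> R by rewrite powR1.
  apply: ge0_ler_powR; rewrite ?nnegrE ?(ltW q0) ?(ltW rho_gt0)//.
  exact: emden_rho_ge1 p1 d0 ysol.
have lowA : c * T <= c * u al 0.
  by rewrite ler_wpM2l ?(ltW c0)// uE ler_peMl.
have upA : u al 0 <= (rho0 + 1) `^ q * T.
  rewrite uE ler_wpM2r// ge0_ler_powR ?nnegrE ?(ltW q0) ?(ltW rho_gt0)//; lra.
have ule x : 0 <= x <= 1 -> `|u al x| <= u al 0.
  move=> /andP[x0 x1]; rewrite (profileK p (ltW al0) u0 x0) normrM gtr0_norm//.
  rewrite ler_piMr ?(ltW u0)//; apply: norm_emden_le1_closed p1 d0 ysol _.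
  rewrite mulr_ge0 ?powR_ge0 ?(ltW rho_gt0)//= ler_piMr ?(ltW rho_gt0)//.
  by rewrite powR_le1 ?x0// invr_ge0 ltW.
have rI j : (1 <= j <= m)%N -> 0 < r al j <= 1 by move=> /rP[].
suff /andP[h1 h2] : c * u al 0 <= Mmax (u al) (r al) i <= u al 0.
  by split; [exact: le_trans h1 | exact: le_trans upA].
rewrite /Mmax; case: eqP => [i1|/eqP i1].
  have /andP[r0 r1] := rI 1%N m0.
  have ub : ubound [set u al x | x in `[0, r al 1%N]] (u al 0).
    move=> v [x /=]; rewrite in_itv/= => /andP[x0 xr] <-.
    by apply: le_trans (ler_norm _) (ule x _); rewrite x0 (le_trans xr).
  have mem : [set u al x | x in `[0, r al 1%N]] (u al 0).
    by exists 0 => //=; rewrite in_itv/= lexx ltW.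
  apply/andP; split; last by apply: ge_sup => //; exists (u al 0).
  apply: (@le_trans _ _ (u al 0)); first by rewrite ler_piMl// ltW.
  by apply: ub_le_sup => //; exists (u al 0).
case: i iI i1 => [//|[//|i]] /andP[_ im] _ /=.
have iI : (1 <= i.+1 <= m)%N by rewrite /= ltnW.
have iI' : (1 <= i.+2 <= m)%N by rewrite im.
have /andP[r0 r1] := rI _ iI; have /andP[r0' r1'] := rI _ iI'.
have ub : ubound [set `|u al x| | x in `[r al i.+1, r al i.+2]] (u al 0).
  move=> v [x /=]; rewrite in_itv/= => /andP[x0 xr] <-.
  by apply: ule; rewrite (le_trans (ltW r0) x0) (le_trans xr).
have [/andP[z0 _] yz] := zP _ iI; have [/andP[_ zr] yz'] := zP _ iI'.
have zlt : zeta al i.+1 < zeta al i.+2 by have [+ _ _ _] := zz; apply; rewrite im.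
have [x /andP[x1 x2] cy] :=
  cP d _ _ dy d0 d1 ysol _ _ z0 zlt zr (le_trans zr rhoB) yz yz'.
pose X := (x / rho al) `^ k al.
have x0 : 0 < x by exact: lt_trans x1.
have xr0 : 0 < x / rho al by rewrite divr_gt0.
have zX j s : zeta al j = s -> 0 <= r al j -> r al j = (s / rho al) `^ k al.
  move=> <- rj; rewrite /zeta mulrC mulKf ?gt_eqF// powRKV// gt_eqF//.
have mono a b : 0 <= a -> a <= b -> (a / rho al) `^ k al <= (b / rho al) `^ k al.
  move=> a0 ab; apply: ge0_ler_powR; first exact: ltW.
  - by rewrite nnegrE divr_ge0// ltW.
  - by rewrite nnegrE divr_ge0 ?(le_trans a0 ab)// ltW.
  - by rewrite ler_pM2r// invr_gt0.
have XI : r al i.+1 <= X <= r al i.+2.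
  rewrite (zX i.+1 _ erefl (ltW r0)) (zX i.+2 _ erefl (ltW r0')).
  by rewrite /X !mono ?(ltW x0) ?(ltW z0) ?(ltW x1) ?(ltW x2).
have mem : [set `|u al x| | x in `[r al i.+1, r al i.+2]] `|u al X|.
  by exists X => //=; rewrite in_itv.
apply/andP; split; last by apply: ge_sup => //; exists `|u al X|.
apply: (@le_trans _ _ `|u al X|); last by apply: ub_le_sup => //; exists (u al 0).
rewrite (profileK p (ltW al0) u0 (powR_ge0 _ _)) /X powRVK ?(ltW xr0) ?gt_eqF//.
rewrite (_ : profile_radius _ _ _ * (x / rho al) = x); last by rewrite mulrC divfK ?gt_eqF.
by rewrite normrM gtr0_norm// mulrC ler_wpM2l ?(ltW u0)// ltW.
Qed.

End Asymptotics.

Theorem theorem1p4 (R : realType) (N : nat) (p : R) (m : nat)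
  (u : R -> R -> R) (w : R -> R) (r : R -> nat -> R) (t : nat -> R) :
  (3 <= N)%N -> 1 < p -> (0 < m)%N ->
  (forall alpha, alpha_p N p < alpha ->
     [/\ radial_dirichlet_sol (fun x : 'rV[R]_N => powR (enorm x) alpha) p (u alpha),
         n_nodal_sets N (u alpha) m &
         0 < u alpha 0]) ->
  [/\ radial_dirichlet_sol (fun _ : 'rV[R]_2 => 1) p w,
      n_nodal_sets 2 w m &
      0 < w 0] ->
  (forall alpha, alpha_p N p < alpha -> zeros_of (u alpha) m (r alpha)) ->
  zeros_of w m t ->
  [/\ (* (i) *)
      (forall i, (1 <= i <= m)%N ->
         (fun alpha => alpha * (1 - r alpha i)) @ +oo --> - 2 * ln (t i)),
      (* (ii) *)
      (forall R0 : R, 0 < R0 < 1 ->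
         forall eps : R, 0 < eps -> exists A : R, forall alpha, A <= alpha ->
           alpha_p N p < alpha ->
           forall x : 'rV[R]_N, enorm x < R0 ->
             `| powR (2 / (alpha + 2)) (2 / (p - 1)) * u alpha (enorm x) - w 0 |
               < eps) &
      (* (iii) *)
      (exists alpha0 : R, exists C1 : R, exists C2 : R,
         [/\ alpha_p N p < alpha0, 0 < C1, 0 < C2 &
           forall i alpha, (1 <= i <= m)%N -> alpha0 <= alpha ->
             C1 * powR ((alpha + 2) / 2) (2 / (p - 1)) <= Mmax (u alpha) (r alpha) i
             /\ Mmax (u alpha) (r alpha) i
                  <= C2 * powR ((alpha + 2) / 2) (2 / (p - 1))])].
Proof.
move=> N3 p1 m0 usol wsol uz wz.
have usol' al : alpha_p N p < al ->
    radial_dirichlet_sol (fun x : 'rV[R]_N => powR (enorm x) al) p (u al) /\ 0 < u al 0.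
  by move=> /usol[].
have wsol' : radial_dirichlet_sol (fun _ : 'rV[R]_2 => 1) p w /\ 0 < w 0.
  by have [? _ ?] := wsol.
have N2 := ltnW N3; split.
- exact: zeros_asymptotics N2 p1 m0 usol' wsol' uz wz.
- exact: center_asymptotics N2 p1 m0 usol' wsol' uz wz.
- exact: Mmax_bounds N2 p1 m0 usol' wsol' uz wz.
Qed.
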